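(* Let $G$ be an undirected connected multigraph with vertex set $[n]$. For a connected partition $\Pi$ of $G$, let $\alpha(\Pi)$ denote the number of acyclic orientations of $G_\Pi$ with a unique sink at the part of $\Pi$ containing vertex $n$. Let $\mathcal P_{k}$ be the set of connected $k$-partitions of $G$. Then for every $k\ge 0$ the Betti numbers of the $G$-parking function ideal $M_G$ and of the toppling ideal $I_G$ are $$\beta_k(R/M_G)=\beta_k(R/I_G)=\sum_{\Pi\in\mathcal P_{k+1}}\alpha(\Pi).$$
   Context: $\mathbb K$ is a field and $R=\mathbb K[x_1,\dots,x_n]$. A multigraph $G$ on $[n]=\{1,\dots,n\}$ is given by its symmetric adjacency matrix $A_G=(a_{ij})$ of nonnegative integers ($a_{ij}$ is the weight of the edge $\{i,j\}$; distinct $i,j$ are adjacent iff $a_{ij}>0$). The $G$-parking function ideal is $M_G=\langle \mathbf x^{S\to\overline S} : \emptyset\ne S\subseteq[n-1]\rangle\subset R$, where $\mathbf x^{S\to\overline S}=\prod_{i\in S}x_i^{\sum_{j\in[n]\setminus S}a_{ij}}$. The Laplacian is $\Lambda_G=\Delta-A_G$ with $\Delta$ diagonal, $\Delta_{ii}=\sum_j a_{ij}$. The toppling ideal is the lattice ideal $I_G=\langle \mathbf x^{u}-\mathbf x^{v} : u,v\in\mathbb N^n,\ u-v\in\mathbb Z^n\Lambda_G\rangle\subset R$, where $\mathbb Z^n\Lambda_G$ is the lattice spanned by the rows of $\Lambda_G$. Both ideals are homogeneous for the standard grading, and $\beta_k(R/I)$ denotes the $k$-th (total, coarse) Betti number,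 i.e. the rank of the $k$-th free module in a minimal graded free resolution of $R/I$ over $R$. A connected $k$-partition of $G$ is a set partition $\Pi$ of $[n]$ into $k$ nonempty parts each of which induces a connected subgraph of $G$. The graph $G_\Pi$ has the parts of $\Pi$ as vertices, with distinct parts $U,W$ joined by a single (weighted) edge iff $\sum_{u\in U,w\in W}a_{uw}>0$. An acyclic orientation of $G_\Pi$ is a choice of direction for each edge between distinct parts producing no directed cycle. *)

(* Defs.v *)
From HB Require Import structures.
From mathcomp Require Import all_boot all_order all_algebra.
From mathcomp Require Import mpoly.

Set Implicit Arguments.
Unset Strict Implicit.
Unset Printing Implicit Defensive.

Import GRing.Theory.
Local Open Scope ring_scope.

(* Ideals are Prop-valued predicates, so that [I_G] needs no decision          *)
(* procedure for membership.                                                   *)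
Definition ideal_gen (R : comNzRingType) (S : R -> Prop) (p : R) : Prop :=
  exists2 s : seq (R * R),
    (forall c, c \in s -> S c.2) & p = \sum_(c <- s) c.1 * c.2.

(* A sequence of finitely generated graded free modules                        *)
(*   ... -> F_2 -> F_1 -> F_0 -> R/I,   F_k = \bigoplus_j R(- fdeg k j),        *)
(* whose elements are row vectors, so that maps act by right multiplication.   *)
(* The map F_0 -> R/I sends v to the class of the entry of v *m faug.          *)
Record free_sequence (K : fieldType) (n : nat) := FreeSequence {
  frank : nat -> nat;
  fdeg : forall k, 'I_(frank k) -> int;
  fdiff : forall k, 'M[{mpoly K[n]}]_(frank k.+1, frank k);
  faug : 'cV[{mpoly K[n]}]_(frank 0)
}.

Arguments fdeg {K n} f k.
Arguments fdiff {K n} f k.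

Section Resolution.
Variables (K : fieldType) (n : nat).
Implicit Types (I : {mpoly K[n]} -> Prop) (F : free_sequence K n).

Definition graded F : Prop :=
  (forall k i j m, m \in msupp (fdiff F k i j) ->
     (mdeg m)%:Z + fdeg F k j = fdeg F k.+1 i) /\
  (forall i m, m \in msupp (faug F i 0) -> (mdeg m)%:Z = fdeg F 0 i).

(* R/I is cyclic, so surjectivity only has to be asked for the class of 1.     *)
Definition exact_resolution I F : Prop :=
  [/\ exists v : 'rV_(frank F 0), I ((v *m faug F) 0 0 - 1),
      forall v : 'rV_(frank F 0),
        I ((v *m faug F) 0 0) <-> exists w, v = w *m fdiff F 0
    & forall k (v : 'rV_(frank F k.+1)),
        v *m fdiff F k = 0 <-> exists w, v = w *m fdiff F k.+1].

(* The image of F_{k+1} lies in (x_1, ..., x_n) F_k.                           *)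
Definition minimal F : Prop := forall k i j, (fdiff F k i j)@_0%MM = 0.

Definition minimal_graded_free_resolution I F : Prop :=
  [/\ graded F, exact_resolution I F & minimal F].

(* beta_k(R/I) = b; that b does not depend on the resolution is part of the    *)
(* definition.                                                                 *)
Definition is_betti I (k b : nat) : Prop :=
  (exists F, minimal_graded_free_resolution I F) /\
  (forall F, minimal_graded_free_resolution I F -> frank F k = b).

End Resolution.

(* The vertex set is 'I_n.+1, with ord_max as the distinguished (last) vertex. *)
(* Diagonal entries of A are unconstrained: loops cancel in the Laplacian and  *)
(* enter no other definition.                                                  *)
Section Ideals.
Variables (K : fieldType) (n : nat) (A : 'M[nat]_n.+1).

Definition cut_monomial (S : {set 'I_n.+1}) : {mpoly K[n.+1]} :=
  \prod_(i in S) 'X_i ^+ (\sum_(j in ~: S) A i j)%N.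

Definition parking_ideal : {mpoly K[n.+1]} -> Prop :=
  ideal_gen (fun p => exists S : {set 'I_n.+1},
    [/\ S != set0, ord_max \notin S & p = cut_monomial S]).

Definition laplacian : 'M[int]_n.+1 :=
  diag_mx (\row_i (\sum_j A i j)%N%:Z) - map_mx Posz A.

Definition toppling_ideal : {mpoly K[n.+1]} -> Prop :=
  ideal_gen (fun p => exists u v : 'X_{1..n.+1},
    (exists c : 'rV[int]_n.+1,
       \row_i ((u i)%:Z - (v i)%:Z) = c *m laplacian)
    /\ p = 'X_[u] - 'X_[v]).

End Ideals.

Arguments parking_ideal K {n} A p.
Arguments toppling_ideal K {n} A p.

Section Orientations.
Variables (T : finType) (P : {set T}) (e : rel T).

(* (x, y) \in D means that the edge {x, y} is directed from x to y.            *)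
Definition orientation (D : {set T * T}) : bool :=
  [forall x, forall y,
     if [&& x \in P, y \in P & e x y]
     then ((x, y) \in D) (+) ((y, x) \in D) else (x, y) \notin D].

Definition acyclic (D : {set T * T}) : bool :=
  [forall x, forall y,
     ((x, y) \in D) ==> ~~ connect [rel a b | (a, b) \in D] y x].

Definition sinks (D : {set T * T}) : {set T} :=
  [set x in P | [forall y, (x, y) \notin D]].

End Orientations.

Section Partitions.
Variables (n : nat) (A : 'M[nat]_n.+1).

Definition adjacent : rel 'I_n.+1 := [rel i j : 'I_n.+1 | (i != j) && (0 < A i j)%N].

Definition connected_on (U : {set 'I_n.+1}) : bool :=
  [forall i in U, forall j in U,
     connect [rel a b | [&& a \in U, b \in U & adjacent a b]] i j].

Definition connected_partitions (k : nat) : {set {set {set 'I_n.+1}}} :=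
  [set Pi : {set {set 'I_n.+1}} |
     [&& partition Pi [set: 'I_n.+1], #|Pi| == k
       & [forall U in Pi, connected_on U]]].

(* Adjacency in the graph G_Pi, whose vertices are the parts of Pi.            *)
Definition part_adjacent : rel {set 'I_n.+1} :=
  [rel U W : {set 'I_n.+1} | (U != W) && (0 < \sum_(u in U) \sum_(w in W) A u w)%N].

Definition alpha (Pi : {set {set 'I_n.+1}}) : nat :=
  #|[set D : {set {set 'I_n.+1} * {set 'I_n.+1}} |
      [&& orientation Pi part_adjacent D, acyclic D
        & sinks Pi D == [set pblock Pi ord_max]]]|.

End Partitions.

(* Main.v *)
(** Remove from [[n]] successively connected sets [W_1, ..., W_k] of vertices
    other than the sink [n], so that what remains stays connected.  Ordering the
    subsets so that larger ones come first, and keeping one normal form for each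
    class of such words under commutation of consecutive letters without an edge
    between them, the words of length [k] correspond to the connected
    [(k+1)]-partitions with an acyclic orientation whose unique sink is the part
    of [n]: the letters are the other parts, and each edge points to the part
    that is removed later.

    The degree of a word is the out-degree sequence of its orientation.  The
    one-letter extensions of a fixed word [w] satisfy Schreyer's colon conditions:
    if the degrees of [w W] and [w V] divide the monomial [M] and [V] comes before
    [W], then some extension of [w W] by a set meeting [V \ W] still divides [M];
    conversely, if [w W W'] divides [M], then so does [w W'] or [w (W u W')].
    Hence division with remainder constructs, one step at a time, a resolution
    with the words as bases.  It starts from the binomials
    [x^(W -> [n]\W) - e x^([n]\W -> W)], where [e = 0] for
    the parking function ideal and [e = 1] for the toppling ideal; in the second
    case the first monomial is the leading one for the weight given by a function
    on the vertices that is strictly superharmonic away from [n].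

    Minimality cannot be read off from the degrees in [K[x_1, ..., x_n]].  The
    resolution is therefore constructed in a ring with one variable for each
    directed edge, where it is homogeneous for the grading by undirected edges;
    the set of edges between parts determines the number of parts, so that no
    entry of a differential is a nonzero constant.  Specializing the variable of
    [(i, j)] to [x_i^(a_ij)] preserves leading terms, and thereby exactness. *)

Require Import Defs.
From HB Require Import structures.
From mathcomp Require Import all_boot all_order all_algebra.
From mathcomp Require Import mpoly zify.
From Stdlib Require Import ClassicalEpsilon.

Set Implicit Arguments.
Unset Strict Implicit.
Unset Printing Implicit Defensive.

Import GRing.Theory Num.Theory Order.Theory.

(** * Independence of the resolution *)

Section IdealGen.
Local Open Scope ring_scope.
Variables (R : comNzRingType) (S : R -> Prop).

Lemma ideal_gen0 : ideal_gen S 0.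
Proof. by exists [::] => //; rewrite big_nil. Qed.

Lemma ideal_genD p q : ideal_gen S p -> ideal_gen S q -> ideal_gen S (p + q).
Proof.
move=> [s sS ->] [t tS ->]; exists (s ++ t); last by rewrite big_cat.
by move=> c; rewrite mem_cat => /orP[/sS|/tS].
Qed.

Lemma ideal_genM a p : ideal_gen S p -> ideal_gen S (a * p).
Proof.
move=> [s sS ->]; exists [seq (a * c.1, c.2) | c <- s].
  by move=> _ /mapP[c /sS ? ->].
by rewrite big_map mulr_sumr; apply: eq_bigr => c _; rewrite mulrA.
Qed.

Lemma ideal_gen_incl p : S p -> ideal_gen S p.
Proof.
move=> Sp; exists [:: (1, p)]; last by rewrite big_seq1 mul1r.
by move=> c; rewrite inE => /eqP ->.
Qed.

Lemma ideal_genB p q : ideal_gen S p -> ideal_gen S q -> ideal_gen S (p - q).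
Proof.
by move=> Ip Iq; apply: ideal_genD => //; rewrite -mulN1r; apply: ideal_genM.
Qed.

Lemma ideal_gen_sum (I : Type) (r : seq I) (P : pred I) (f : I -> R) :
  (forall i, P i -> ideal_gen S (f i)) -> ideal_gen S (\sum_(i <- r | P i) f i).
Proof.
by move=> If; elim/big_ind: _ => //; [apply: ideal_gen0 | apply: ideal_genD].
Qed.

Lemma ideal_gen_sub (T : R -> Prop) p :
  (forall q, S q -> ideal_gen T q) -> ideal_gen S p -> ideal_gen T p.
Proof.
move=> ST [s sS ->]; rewrite big_seq.
elim/big_ind: _ => [|p1 p2 [s1 s1T ->] [s2 s2T ->]|c /sS/ST [t tT ->]].
- by exists [::] => //; rewrite big_nil.
- exists (s1 ++ s2); last by rewrite big_cat.
  by move=> d; rewrite mem_cat => /orP[/s1T|/s2T].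
exists [seq (c.1 * d.1, d.2) | d <- t]; first by move=> _ /mapP[d /tT ? ->].
by rewrite big_map mulr_sumr; apply: eq_bigr => d _; rewrite mulrA.
Qed.

End IdealGen.

(** * Comparison of resolutions up to homotopy *)

Section Comparison.
Local Open Scope ring_scope.
Variables (K : fieldType) (n : nat) (J : {mpoly K[n]} -> Prop).
Local Notation I := (ideal_gen J).
Implicit Types F G H : free_sequence K n.

Definition const_part a b (M : 'M[{mpoly K[n]}]_(a, b)) : 'M[K]_(a, b) :=
  map_mx (mcoeff 0%MM) M.

Lemma const_partD a b (M N : 'M[{mpoly K[n]}]_(a, b)) :
  const_part (M + N) = const_part M + const_part N.
Proof. by apply/matrixP=> i j; rewrite !mxE mcoeffD. Qed.

Lemma const_partM a b c (M : 'M[{mpoly K[n]}]_(a, b)) (N : 'M_(b, c)) :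
  const_part (M *m N) = const_part M *m const_part N.
Proof.
apply/matrixP=> i j; rewrite !mxE raddf_sum; apply: eq_bigr => l _.
by rewrite !mxE /= rmorphM.
Qed.

Lemma const_part1 a : const_part (1%:M : 'M[{mpoly K[n]}]_a) = 1%:M.
Proof. by apply/matrixP=> i j; rewrite !mxE mcoeffMn mcoeff1 eqxx. Qed.

(** Only the component in degree [k] is visible; the lower ones are existential. In degree 0 the
    augmentations need to agree modulo the ideal only. *)
Fixpoint chain_map F G (k : nat) : 'M[{mpoly K[n]}]_(frank F k, frank G k) -> Prop :=
  match k with
  | 0 => fun f => forall i, I ((f *m faug G - faug F) i 0)
  | k'.+1 => fun f => exists2 g, chain_map (k := k') g
                        & f *m fdiff G k' = fdiff F k' *m g
  end.
Arguments chain_map F G k _ : clear implicits.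

Lemma mx_lift a b c (M : 'M[{mpoly K[n]}]_(a, b)) (N : 'M_(c, b)) :
  (forall i, exists w, row i M = w *m N) -> exists X, M = X *m N.
Proof.
move=> h; have [f fP] := fin_all_exists h.
exists (\matrix_i f i); apply/row_matrixP => i.
by rewrite row_mul rowK fP.
Qed.

Lemma diff_sq F k : exact_resolution I F -> fdiff F k.+1 *m fdiff F k = 0.
Proof.
move=> [_ _ ex]; apply/row_matrixP => i; rewrite row_mul row0.
by apply/ex; exists (delta_mx 0 i); rewrite -rowE.
Qed.

Lemma diff_aug F i : exact_resolution I F -> I ((fdiff F 0 *m faug F) i 0).
Proof.
move=> [_ ex _]; have /ex : exists w, row i (fdiff F 0) = w *m fdiff F 0.
  by exists (delta_mx 0 i); rewrite -rowE.
by rewrite -row_mul mxE.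
Qed.

Lemma mx_ideal a b c (M : 'M[{mpoly K[n]}]_(a, b)) (N : 'M_(b, c)) :
  (forall i j, I (N i j)) -> forall i j, I ((M *m N) i j).
Proof.
by move=> NI i j; rewrite mxE; apply: ideal_gen_sum => l _; apply: ideal_genM.
Qed.

Lemma chain_map_next F G k f :
  exact_resolution I F -> exact_resolution I G -> chain_map F G k f ->
  exists f', f' *m fdiff G k = fdiff F k *m f.
Proof.
move=> exF exG cf.
suff [X ->] : exists X, fdiff F k *m f = X *m fdiff G k by exists X.
case: k f cf => [|k] f /= cf; apply: mx_lift => i.
  have [_ ex _] := exG; apply/ex.
  rewrite -row_mul mxE -mulmxA.
  have -> : f *m faug G = (f *m faug G - faug F) + faug F by rewrite subrK.
  rewrite mulmxDr mxE; apply: ideal_genD; last exact: diff_aug.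
  by apply: mx_ideal => i' j'; rewrite (ord1 j').
have [_ _ ex] := exG; apply/ex.
case: cf => g _ e; rewrite -row_mul -mulmxA e mulmxA diff_sq //.
by rewrite mul0mx row0.
Qed.

Lemma chain_map_exists F G k :
  exact_resolution I F -> exact_resolution I G -> exists f, chain_map F G k f.
Proof.
move=> exF exG; elim: k => [|k [f cf]]; last first.
  by have [f' e] := chain_map_next exF exG cf; exists f', f.
(* [v] lifts the class of 1, so [faug F *m v] lifts the augmentation of [F] modulo the ideal. *)
have [[v vP] _ _] := exG; exists (faug F *m v) => i.
rewrite -mulmxA -{2}(mulmx1 (faug F)) -mulmxBr.
apply: mx_ideal => a b; rewrite (ord1 a) (ord1 b); move: vP.
by rewrite !mxE eqxx.
Qed.

Lemma chain_map_comp F G H k f g :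
  chain_map F G k f -> chain_map G H k g -> chain_map F H k (f *m g).
Proof.
elim: k f g => [|k IH] f g /=.
  move=> cf cg i; have -> : f *m g *m faug H - faug F =
    f *m (g *m faug H - faug G) + (f *m faug G - faug F).
    by rewrite mulmxBr mulmxA addrA subrK.
  rewrite mxE; apply: ideal_genD => //.
  by apply: mx_ideal => a b; rewrite (ord1 b).
move=> [f' cf' ef] [g' cg' eg]; exists (f' *m g'); first exact: IH.
by rewrite -mulmxA eg mulmxA ef mulmxA.
Qed.

Lemma chain_map_id F k : chain_map F F k 1%:M.
Proof.
elim: k => [|k IH] /=; first by move=> i; rewrite mul1mx subrr mxE; apply: ideal_gen0.
by exists 1%:M; rewrite // mul1mx mulmx1.
Qed.

(* The error term [e] is the part [d_(k-1) h_(k-1)] of a chain homotopy. *)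
Lemma chain_map_homotopy F G k f f' :
  exact_resolution I F -> exact_resolution I G -> minimal F ->
  chain_map F G k f -> chain_map F G k f' ->
  exists h e, [/\ f - f' = h *m fdiff G k + e, fdiff F k *m e = 0
                & const_part e = 0].
Proof.
move=> exF exG mF; elim: k f f' => [|k IH] f f' /=.
  move=> cf cf'.
  suff [X eX] : exists X, f - f' = X *m fdiff G 0.
    exists X, 0; rewrite addr0 mulmx0; split=> //.
    by apply/matrixP=> i j; rewrite !mxE mcoeff0.
  apply: mx_lift => i; have [_ ex _] := exG; apply/ex.
  rewrite -row_mul mxE mulmxBl.
  have -> : f *m faug G - f' *m faug G =
     (f *m faug G - faug F) - (f' *m faug G - faug F).
    by rewrite opprB addrA subrK.
  by rewrite mxE [X in _ + X]mxE; apply: ideal_genB.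
move=> [g cg eg] [g' cg' eg']; have [h [e [eh ee ce]]] := IH _ _ cg cg'.
have kz : (f - f' - fdiff F k *m h) *m fdiff G k = 0.
  rewrite !mulmxBl eg eg' -mulmxBr eh mulmxDr ee addr0 mulmxA.
  by rewrite subrr.
have [X eX] : exists X, f - f' - fdiff F k *m h = X *m fdiff G k.+1.
  apply: mx_lift => i; have [_ _ ex] := exG; apply/ex.
  by rewrite -row_mul kz row0.
exists X, (fdiff F k *m h); split.
- by rewrite -eX subrK.
- by rewrite mulmxA diff_sq // mul0mx.
rewrite const_partM; suff -> : const_part (fdiff F k) = 0 by rewrite mul0mx.
by apply/matrixP=> i j; rewrite mxE mF mxE.
Qed.

(** Comparison maps in both directions compose to an endomorphism of [F] homotopic to the identity.
    Modulo the variables the homotopy vanishes by minimality of [F], so an identity matrix factors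
    through the rank of [G]. *)
Lemma minimal_rank_le F G k :
  exact_resolution I F -> exact_resolution I G -> minimal F ->
  (frank F k <= frank G k)%N.
Proof.
move=> exF exG mF.
have [f cf] := chain_map_exists k exF exG.
have [g cg] := chain_map_exists k exG exF.
have [h [e [eh _ ce]]] := chain_map_homotopy exF exF mF
  (chain_map_comp cf cg) (chain_map_id F k).
have : const_part (f *m g) = 1%:M.
  rewrite -(subrK 1%:M (f *m g)) eh !const_partD const_partM ce const_part1.
  suff -> : const_part (fdiff F k) = 0 by rewrite mulmx0 !add0r.
  by apply/matrixP=> i j; rewrite mxE mF mxE.
by rewrite const_partM => /mulmx1_min.
Qed.

Lemma is_betti_of_resolution F k :
  minimal_graded_free_resolution I F -> is_betti I k (frank F k).
Proof.
move=> rF; split; first by exists F.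
case: rF => _ exF mF G [_ exG mG]; apply/eqP; rewrite eqn_leq.
by rewrite !minimal_rank_le.
Qed.

End Comparison.

(** * Schreyer frames *)

Section Terms.
Local Open Scope ring_scope.
Variables (K : fieldType) (N r : nat) (E : 'I_r -> 'X_{1..N}).
Implicit Types (u v : 'rV[{mpoly K[N]}]_r) (P : 'X_{1..N} -> 'I_r -> Prop).

Definition term (m : 'X_{1..N}) (i : 'I_r) : 'rV[{mpoly K[N]}]_r :=
  'X_[m] *: delta_mx 0 i.

(** The predicate sees the multidegree [m + E i], with the basis vector [i] placed in degree [E i],
    rather than the exponent [m]. *)
Definition all_terms P v : Prop :=
  forall i m, m \in msupp (v 0 i) -> P (m + E i)%MM i.

Lemma termE m i j : term m i 0 j = if j == i then 'X_[m] else 0.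
Proof. by rewrite !mxE eqxx /=; case: eqP => _; rewrite ?mulr1 ?mulr0. Qed.

Lemma term_ind (P : 'rV[{mpoly K[N]}]_r -> Prop) v :
  P 0 -> (forall u w, P u -> P w -> P (u + w)) ->
  (forall a u, P u -> P (a%:MP *: u)) ->
  (forall i m, m \in msupp (v 0 i) -> P (term m i)) -> P v.
Proof.
move=> P0 PD PZ Pt; rewrite (row_sum_delta v).
apply: (big_ind P) => // i _; rewrite [v 0 i]mpolyE scaler_suml big_seq.
apply: (big_ind P) => // m mi; rewrite -mul_mpolyC -scalerA.
by apply: PZ; apply: Pt.
Qed.

Lemma all_terms0 P : all_terms P 0.
Proof. by move=> i m; rewrite mxE msupp0. Qed.

Lemma all_termsD P u v : all_terms P u -> all_terms P v -> all_terms P (u + v).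
Proof.
move=> Pu Pv i m; rewrite mxE => /msuppD_le; rewrite mem_cat.
by case/orP=> [/Pu|/Pv].
Qed.

Lemma all_termsC P a v : all_terms P v -> all_terms P (a%:MP *: v).
Proof. by move=> Pv i m; rewrite mxE mul_mpolyC => /msuppZ_le/Pv. Qed.

Lemma all_termsN P v : all_terms P v -> all_terms P (- v).
Proof. by move=> Pv i m; rewrite mxE (perm_mem (msuppN _)) => /Pv. Qed.

Lemma all_terms_term P m i : P (m + E i)%MM i -> all_terms P (term m i).
Proof.
move=> Pm j m'; rewrite termE; case: eqP => [->|_]; last by rewrite msupp0.
by rewrite msuppX inE => /eqP ->.
Qed.

Lemma all_terms_impl P Q v :
  (forall M i, P M i -> Q M i) -> all_terms P v -> all_terms Q v.
Proof. by move=> PQ Pv i m /Pv/PQ. Qed.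

Lemma all_termsX P Q m v :
  (forall M i, P M i -> Q (m + M)%MM i) -> all_terms P v ->
  all_terms Q ('X_[m] *: v).
Proof.
move=> PQ Pv i m'; rewrite mxE mulrC (perm_mem (msuppMX _ _)).
by case/mapP=> m'' /Pv/PQ; rewrite addmA => h ->.
Qed.

Lemma all_terms_coef P v m i : all_terms P v -> ~ P (m + E i)%MM i ->
  (v 0 i)@_m = 0.
Proof. by move=> Pv nP; apply/memN_msupp_eq0/negP => /Pv. Qed.

Lemma all_terms_eq0 P v : all_terms P v -> (forall M i, ~ P M i) -> v = 0.
Proof.
move=> Pv nP; apply/matrixP=> i j; rewrite (ord1 i) [RHS]mxE.
by apply/mpolyP=> m; rewrite mcoeff0; apply: all_terms_coef Pv _.
Qed.

End Terms.

Definition submodule (R : comNzRingType) (V : lmodType R) (Z : V -> Prop) :=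
  [/\ Z 0%R, forall u v, Z u -> Z v -> Z (u - v)%R & forall a u, Z u -> Z (a *: u)%R].

Section Frame.
Local Open Scope ring_scope.
Variables (N : nat) (r : nat -> nat) (par : forall k, 'I_(r k.+1) -> 'I_(r k)).
Variables (B : nat) (c : forall k, 'I_(r k.+1) -> nat).
Arguments par {k}.
Arguments c {k}.

(** The values of [c] along the path to [j], read as digits in base [B]; when they are all below
    [B], this orders paths lexicographically. *)
Fixpoint lex_rank k : 'I_(r k) -> nat :=
  match k with
  | 0 => fun _ => 0%N
  | k'.+1 => fun j => (lex_rank (par j) * B + c j)%N
  end.

Variables (E : forall k, 'I_(r k) -> 'X_{1..N}) (wt : 'X_{1..N} -> nat).
Arguments E {k}.

(** Schreyer's induced order, encoded as a number: first the weight of [M], then the path of [i].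
    Passing to a child appends one digit ([term_rankS]), and division terminates by induction on
    numbers. *)
Definition term_rank k (M : 'X_{1..N}) (i : 'I_(r k)) : nat :=
  (wt M * B ^ k + lex_rank i)%N.

(* The last clause is Schreyer's condition on colon ideals, phrased degree by  *)
(* degree: among the children [j] of [i] whose degree divides [M], exactly the *)
(* first one has no child whose degree divides [M].                            *)
Record schreyer_frame : Prop := SchreyerFrame {
  frame_degD : forall m m', wt (m + m')%MM = (wt m + wt m')%N;
  frame_rank_lt : forall k (j : 'I_(r k.+1)), (c j < B)%N;
  frame_rank_inj : forall k (j j' : 'I_(r k.+1)), par j = par j' -> c j = c j' -> j = j';
  frame_par_le : forall k (j : 'I_(r k.+1)), (E (par j) <= E j)%MM;
  frame_colon : forall k (j : 'I_(r k.+1)) (M : 'X_{1..N}), (E j <= M)%MM ->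
    (exists l, par l = j /\ (E l <= M)%MM) <->
    (exists j', [/\ par j' = par j, (E j' <= M)%MM & (c j' < c j)%N])
}.

(** These are the standard monomials of Gröbner basis theory: no leading term attached to a child of
    [i] divides the term. *)
Definition standard k (M : 'X_{1..N}) (i : 'I_(r k)) : bool :=
  [forall j : 'I_(r k.+1), (par j == i) ==> ~~ (E j <= M)%MM].

Variables (K : fieldType) (T : Type) (gam : 'X_{1..N} -> T).
Local Notation S := {mpoly K[N]}.

(** The map [gam] carries a homogeneity condition along; a constant [gam] makes this condition
    trivial. *)
Definition leading_terms k (d : 'M[S]_(r k.+1, r k)) : Prop :=
  forall j, exists2 l, row j d = term K (E j - E (par j))%MM (par j) + l &
    all_terms E (fun M i => (term_rank M i < term_rank (E j) (par j))%N
                              /\ gam M = gam (E j)) l.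

(** For a [Z] containing the rows of a matrix with these leading terms, this plays the part of the
    Gröbner basis property. *)
Definition no_standard k (Z : 'rV[S]_(r k) -> Prop) : Prop :=
  forall z, Z z -> all_terms E (fun M i => standard M i) z -> z = 0.

Hypothesis frameE : schreyer_frame.
Hypothesis gamD : forall m M M', gam M = gam M' -> gam (m + M)%MM = gam (m + M')%MM.

Lemma term_rankD k m M (i : 'I_(r k)) :
  term_rank (m + M) i = (wt m * B ^ k + term_rank M i)%N.
Proof. by rewrite /term_rank frame_degD // mulnDl addnA. Qed.

Lemma term_rankS k M (j : 'I_(r k.+1)) :
  term_rank M j = (term_rank M (par j) * B + c j)%N.
Proof. by rewrite /term_rank /= expnSr mulnA mulnDl addnA. Qed.

(** Among the children of [i] whose degree divides [M], the one with least [c] has no child dividing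
    [M], by the colon condition. *)
Lemma standardPn k M (i : 'I_(r k)) : ~~ standard M i ->
  exists j : 'I_(r k.+1), [/\ par j = i, (E j <= M)%MM & standard M j].
Proof.
rewrite negb_forall => /existsP[j0]; rewrite negb_imply negbK => j0P.
pose P (j : 'I_(r k.+1)) := (par j == i) && (E j <= M)%MM.
case: (@arg_minnP _ j0 P c j0P) => j /andP[/eqP pj Ej] minj.
exists j; split=> //; apply/forallP => l; apply/implyP => /eqP pl.
apply/negP => El; have [+ _] := frame_colon frameE Ej.
case; first by exists l.
move=> j' [pj' Ej' lt]; move: (minj j'); rewrite /P pj' pj eqxx Ej' => /(_ isT).
by rewrite leqNgt lt.
Qed.

(** Of two distinct such children, the colon condition would give the one with larger [c] a child
    whose degree divides [M]. *)
Lemma standard_inj k M (j j' : 'I_(r k.+1)) :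
  par j = par j' -> (E j <= M)%MM -> (E j' <= M)%MM ->
  standard M j -> standard M j' -> j = j'.
Proof.
have wl (i i' : 'I_(r k.+1)) : par i = par i' -> (E i <= M)%MM ->
    (E i' <= M)%MM -> standard M i' -> (c i' <= c i)%N.
  move=> pi Ei Ei' /forallP st; rewrite leqNgt; apply/negP => lt.
  have [_ []] := frame_colon frameE Ei'; first by exists i.
  by move=> l [pl El]; move: (st l); rewrite pl eqxx El.
move=> pj Ej Ej' s s'; apply: (frame_rank_inj frameE) => //.
by apply/eqP; rewrite eqn_leq !wl.
Qed.

(** * Division with remainder and syzygies *)

Section Reduction.
Variables (k : nat) (d : 'M[S]_(r k.+1, r k)).
Hypothesis ltd : leading_terms d.

(** Division with quotient [w] and remainder [v - w *m d]; [r0] bounds the leading terms of the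
    images of the quotient terms. *)
Definition reducible (r0 : nat) (Q : 'X_{1..N} -> Prop) (v : 'rV[S]_(r k)) : Prop :=
  exists2 w, all_terms E (fun M (j : 'I_(r k.+1)) =>
                 [/\ standard M j, (term_rank M (par j) < r0)%N & Q M]) w
           & all_terms E (fun M i => standard M i) (v - w *m d).

Lemma reducible0 r0 Q : reducible r0 Q 0.
Proof. by exists 0; rewrite ?mul0mx ?subr0; apply: all_terms0. Qed.

Lemma reducibleD r0 Q u v :
  reducible r0 Q u -> reducible r0 Q v -> reducible r0 Q (u + v).
Proof.
move=> [w1 a1 b1] [w2 a2 b2]; exists (w1 + w2); first exact: all_termsD.
by rewrite mulmxDl opprD addrACA; exact: all_termsD b1 b2.
Qed.

Lemma reducibleC r0 Q a v : reducible r0 Q v -> reducible r0 Q (a%:MP *: v).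
Proof.
move=> [w1 a1 b1]; exists (a%:MP *: w1); first exact: all_termsC.
by rewrite -scalemxAl -scalerBr; apply: all_termsC.
Qed.

Lemma reducibleW r0 r1 Q v :
  (r0 <= r1)%N -> reducible r0 Q v -> reducible r1 Q v.
Proof.
move=> le [w aw bw]; exists w => //; apply: all_terms_impl aw => M i [? ? ?].
by split=> //; apply: leq_trans le.
Qed.

Lemma term_mul m (j : 'I_(r k.+1)) : term K m j *m d = 'X_[m] *: row j d.
Proof. by rewrite /term -scalemxAl -rowE. Qed.

Lemma leading_mul m (j : 'I_(r k.+1)) : exists2 l,
    'X_[m] *: row j d = term K (m + E j - E (par j))%MM (par j) + l &
    all_terms E (fun M i => (term_rank M i < term_rank (m + E j) (par j))%N
                              /\ gam M = gam (m + E j)%MM) l.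
Proof.
have [l -> al] := ltd j; exists ('X_[m] *: l).
  rewrite scalerDr /term scalerA -mpolyXD addmBA //.
  exact: (frame_par_le frameE).
apply: all_termsX al => M i [lt eg]; split; last exact: gamD.
by rewrite !term_rankD ltn_add2l.
Qed.

(** Induction on the rank: a term that is not standard is the leading term of a multiple of the row
    given by [standardPn], and subtracting this multiple leaves terms of smaller rank. *)
Lemma reducible_term r0 (Q : 'X_{1..N} -> Prop) m (i : 'I_(r k)) :
  (forall M M', gam M = gam M' -> Q M' -> Q M) ->
  (term_rank (m + E i) i < r0)%N -> Q (m + E i)%MM ->
  reducible r0 Q (term K m i).
Proof.
move=> Qg; elim: r0 m i => // r0 IH m i lt QM.
have [st|] := boolP (standard (m + E i)%MM i).
  exists 0; first exact: all_terms0.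
  by rewrite mul0mx subr0; apply: all_terms_term.
move=> /standardPn[j [pj Ej stj]].
have [l el al] := leading_mul (m + E i - E j)%MM j.
rewrite submK // pj addmK in el al.
rewrite -(addrK l (term K m i)) -el; apply: reducibleD.
  exists (term K (m + E i - E j)%MM j).
    by apply: all_terms_term; rewrite submK // pj.
  by rewrite term_mul subrr; apply: all_terms0.
apply: (@reducibleW r0) => //.
have := all_termsN al => {}al.
apply: term_ind (@reducible0 _ _) (@reducibleD _ _) (@reducibleC _ _) _.
move=> i' m' /al[lt' eg]; apply: IH; first exact: leq_trans lt' _.
exact: Qg eg QM.
Qed.

Lemma reducible_all r0 (Q : 'X_{1..N} -> Prop) v :
  (forall M M', gam M = gam M' -> Q M' -> Q M) ->
  all_terms E (fun M i => (term_rank M i < r0)%N /\ Q M) v -> reducible r0 Q v.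
Proof.
move=> Qg av.
apply: term_ind (@reducible0 _ _) (@reducibleD _ _) (@reducibleC _ _) _.
by move=> i m /av[lt QM]; apply: reducible_term.
Qed.

Lemma reduction v :
  exists w, all_terms E (fun M i => standard M i) (v - w *m d).
Proof.
pose P v := exists w, all_terms E (fun M i => standard M i) (v - w *m d).
apply: (@term_ind _ _ _ P).
- by exists 0; rewrite mul0mx subr0; apply: all_terms0.
- move=> u1 u2 [w1 h1] [w2 h2]; exists (w1 + w2).
  by rewrite mulmxDl opprD addrACA; exact: all_termsD h1 h2.
- move=> a u [w1 h1]; exists (a%:MP *: w1).
  by rewrite -scalemxAl -scalerBr; apply: all_termsC.
move=> i m _.
have [//|//|//|w _ h] := @reducible_term (term_rank (m + E i) i).+1 (fun=> True) m i.
by exists w.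
Qed.

(** The remainder of an element of [Z] is standard and still lies in [Z], hence vanishes. *)
Lemma exact_of_no_standard (Z : 'rV[S]_(r k) -> Prop) v :
  submodule Z -> no_standard Z -> (forall j, Z (row j d)) ->
  Z v <-> exists w, v = w *m d.
Proof.
move=> [Z0 ZB ZZ] nZ Zd.
have Zw w : Z (w *m d).
  rewrite mulmx_sum_row.
  apply: (big_ind Z) => // [u1 u2 Z1 Z2|j _]; last exact: ZZ.
  by rewrite -(opprK u2) -[- u2]sub0r; apply: (ZB _ _ Z1); apply: ZB.
split=> [Zv|[w ->]]; last exact: Zw.
have [w sw] := reduction v; exists w; apply/eqP; rewrite -subr_eq0; apply/eqP.
by apply: nZ => //; apply: ZB.
Qed.

(* The leading terms of the images of standard terms are pairwise distinct.   *)
Lemma no_standard_ker : no_standard (fun z : 'rV[S]_(r k.+1) => z *m d = 0).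
Proof.
move=> z zd sz.
(* Induction on a bound for the ranks of the leading terms of the images, starting from their
   maximum over the support of [z]. *)
suff H r0 : forall z : 'rV[S]_(r k.+1), all_terms E (fun M i => standard M i) z ->
    all_terms E (fun M (j : 'I_(r k.+1)) => (term_rank M (par j) < r0)%N) z ->
    z *m d = 0 -> z = 0.
  pose f (p : S) (j : 'I_(r k.+1)) := \max_(m <- msupp p) term_rank (m + E j) (par j).
  apply: (H (\max_j f (z 0%R j) j).+1) => // j m mj; rewrite ltnS.
  apply: leq_trans (leq_bigmax j); rewrite /f.
  exact: (@leq_bigmax_seq _ _ xpredT (fun m => term_rank (m + E j) (par j))).
elim: r0 => [|r0 IH] {sz zd}z sz lz zd.
  by apply: all_terms_eq0 lz _ => M i; rewrite ltn0.
apply: IH => // j0 m0 mz; rewrite ltnNge; apply/negP => ge.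
have := lz _ _ mz; rewrite ltnS => le.
have {ge le} rk : term_rank (m0 + E j0) (par j0) = r0 by apply/eqP; rewrite eqn_leq le.
(* Suppose a term of [z] attains the bound. [P] reads the coefficient of its leading term in the
   image; the other terms, collected in [z'], do not contribute, by rank or by [standard_inj]. *)
pose a := (z 0 j0)@_m0; pose z' := z - a%:MP *: term K m0 j0.
pose M0 := (m0 + E j0)%MM; pose m1 := (M0 - E (par j0))%MM.
have E0 : (m1 + E (par j0))%MM = M0.
  by rewrite submK // (lepm_trans (frame_par_le frameE j0)) // lem_addl.
pose P (u : 'rV[S]_(r k.+1)) := ((u *m d) 0 (par j0))@_m1.
have Pz' : P z' = 0.
  apply: (@term_ind _ _ _ (fun u => P u = 0)); rewrite /P.
  - by rewrite mul0mx mxE mcoeff0.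
  - by move=> u w u0 w0; rewrite mulmxDl mxE mcoeffD u0 w0 addr0.
  - by move=> b u u0; rewrite -scalemxAl mxE mul_mpolyC mcoeffZ u0 mulr0.
  move=> j m; rewrite mcoeff_msupp.
  have -> : z' 0 j = z 0 j - a%:MP * term K m0 j0 0 j.
    by rewrite /z'; move: (term K m0 j0) => t; rewrite !mxE.
  rewrite mul_mpolyC mcoeffB mcoeffZ termE => nz.
  have jmz : m \in msupp (z 0 j).
    rewrite mcoeff_msupp; move: nz; case: (j =P j0) => [->|_].
      rewrite mcoeffX; case: (m0 =P m) => [<- _|_]; last by rewrite mulr0 subr0.
      by move: mz; rewrite mcoeff_msupp.
    by rewrite mcoeff0 mulr0 subr0.
  have ne : ~ (j = j0 /\ m = m0).
    by move=> [ej em]; move: nz; rewrite ej em eqxx mcoeffX eqxx mulr1 subrr eqxx.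
  rewrite term_mul; have [l -> al] := leading_mul m j.
  rewrite mxE mcoeffD termE; have -> : (l 0 (par j0))@_m1 = 0.
    apply: all_terms_coef al _ => -[+ _]; rewrite E0 rk.
    by move/leq_ltn_trans/(_ (lz _ _ jmz)); rewrite ltnS ltnn.
  rewrite addr0; case: eqP => [epar|_]; last by rewrite mcoeff0.
  rewrite mcoeffX; case: eqP => // em; case: ne.
  have eM : M0 = (m + E j)%MM.
    rewrite -E0 -em epar submK //.
    by rewrite (lepm_trans (frame_par_le frameE j)) // lem_addl.
  have ej : j = j0.
    apply: (@standard_inj _ M0); rewrite ?epar // ?eM ?lem_addl //.
    - by rewrite -eM lem_addl.
    - exact: (sz _ _ jmz).
    by rewrite -eM; apply: (sz _ _ mz).
  by split=> //; apply: (@addIm _ (E j)); rewrite -eM ej.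
have : P z = 0 by rewrite /P zd mxE mcoeff0.
rewrite -(subrK (a%:MP *: term K m0 j0) z) -/z' /P mulmxDl mxE mcoeffD.
rewrite -/(P z') Pz' add0r -scalemxAl mxE mul_mpolyC mcoeffZ term_mul.
have [l -> al] := leading_mul m0 j0.
rewrite mxE mcoeffD termE eqxx mcoeffX eqxx.
have -> : (l 0 (par j0))@_m1 = 0.
  by apply: all_terms_coef al _ => -[+ _]; rewrite E0 ltnn.
by rewrite addr0 mulr1 => a0; move: mz; rewrite mcoeff_msupp -/a a0 eqxx.
Qed.

(** Schreyer's syzygies: [l] encodes the S-pair of its parent [j] with the standard sibling [j1]
    dividing [E l]. The leading terms cancel, and dividing what is left by the rows gives remainder
    0, as it lies in [Z] and is standard. *)
Lemma lift_leading (Z : 'rV[S]_(r k) -> Prop) :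
  submodule Z -> no_standard Z -> (forall j, Z (row j d)) ->
  exists2 d' : 'M[S]_(r k.+2, r k.+1), d' *m d = 0 & leading_terms d'.
Proof.
move=> sZ nZ Zd.
have Zw w : Z (w *m d) by apply/(exact_of_no_standard _ sZ nZ Zd); exists w.
suff /fin_all_exists[f fP] : forall l : 'I_(r k.+2), exists v : 'rV[S]_(r k.+1),
    v *m d = 0 /\ exists2 u, v = term K (E l - E (par l))%MM (par l) + u &
      all_terms E (fun M i => (term_rank M i < term_rank (E l) (par l))%N
                              /\ gam M = gam (E l)) u.
  exists (\matrix_l f l).
    by apply/row_matrixP=> l; rewrite row_mul rowK row0; case: (fP l).
  by move=> l; rewrite rowK; case: (fP l).
move=> l; set j := par l; pose M := E l; pose i := par j.
have Ej : (E j <= M)%MM := frame_par_le frameE l.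
have nst : ~~ standard M i.
  by apply/negP => /forallP/(_ j); rewrite eqxx Ej.
have [j1 [pj1 Ej1 st1]] := standardPn nst.
(* [j1] has the least [c] among the siblings dividing [M]; [j] does not, because its child [l]
   divides [M]. *)
have clt : (c j1 < c j)%N.
  have [+ _] := frame_colon frameE Ej.
  case; first by exists l; rewrite lepm_refl.
  move=> j2 [pj2 Ej2 lt2]; apply: leq_ltn_trans lt2; rewrite leqNgt; apply/negP => lt1.
  have [_ []] := frame_colon frameE Ej1; first by exists j2; rewrite pj1.
  by move=> l1 [pl1 El1]; move/forallP/(_ l1): st1; rewrite pl1 eqxx El1.
have [l0 el0 al0] := leading_mul (M - E j)%MM j.
have [l1 el1 al1] := leading_mul (M - E j1)%MM j1.
rewrite !submK // in el0 al0 el1 al1; rewrite pj1 -/i in el0 al0 el1 al1.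
have al : all_terms E (fun M' i' => (term_rank M' i' < term_rank M i)%N
                          /\ gam M' = gam M) (l0 - l1).
  by apply: all_termsD => //; apply: all_termsN.
have [//|w aw bw] := reducible_all (Q := fun M' => gam M' = gam M) _ al.
  by move=> M1 M2 -> .
pose u : 'rV[S]_(r k.+1) := - term K (M - E j1)%MM j1 - w.
have ev : term K (M - E j)%MM j + u = (term K (M - E j)%MM j - term K (M - E j1)%MM j1) - w.
  by rewrite addrA.
have el : l0 - l1 = (term K (M - E j)%MM j - term K (M - E j1)%MM j1) *m d.
  by rewrite mulmxBl !term_mul el0 el1 opprD addrACA subrr add0r.
exists (term K (M - E j)%MM j + u); split.
  rewrite ev mulmxBl -el; apply: nZ bw.
  by rewrite el -mulmxBl; apply: Zw.
exists u => //; apply: all_termsD; apply: all_termsN.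
  apply: all_terms_term; rewrite submK //; split=> //.
  by rewrite !term_rankS pj1 ltn_add2l.
apply: all_terms_impl aw => M' j' [_ lt ->]; split=> //.
(* A smaller rank at the parent outweighs the last digit, which is below [B]. *)
rewrite !term_rankS; apply: (@leq_trans ((term_rank M' (par j')).+1 * B)%N).
  by rewrite mulSn addnC ltn_add2r; apply: (frame_rank_lt frameE).
by apply: leq_trans (leq_addr _ _); rewrite leq_mul2r lt orbT.
Qed.

End Reduction.

Lemma submodule_ker k (d : 'M[S]_(r k.+1, r k)) :
  submodule (fun z : 'rV[S]_(r k.+1) => z *m d = 0).
Proof.
split; first by rewrite mul0mx.
  by move=> u v; rewrite mulmxBl => -> ->; rewrite subrr.
by move=> a u; rewrite -scalemxAl => ->; rewrite scaler0.
Qed.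

Definition differentials (Z : 'rV[S]_(r 0) -> Prop)
    (d : forall k, 'M[S]_(r k.+1, r k)) : Prop :=
  [/\ forall j, Z (row j (d 0%N)), forall k, d k.+1 *m d k = 0
    & forall k, leading_terms (d k)].

Lemma differentials_exact0 Z d v : submodule Z -> no_standard Z ->
  differentials Z d -> Z v <-> exists w, v = w *m d 0%N.
Proof. by move=> sZ nZ [Zd _ ltd]; apply: exact_of_no_standard. Qed.

Lemma differentials_exact Z d k (v : 'rV[S]_(r k.+1)) :
  differentials Z d -> v *m d k = 0 <-> exists w, v = w *m d k.+1.
Proof.
move=> [_ dd ltd].
apply: (exact_of_no_standard (ltd k.+1) _ (submodule_ker _) (no_standard_ker (ltd k))).
by move=> j; rewrite -row_mul dd row0.
Qed.

(** Each map is chosen after the previous one. The recursion carries the existence of a submodule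
    that contains the rows and has no nonzero standard element: first [Z], then the kernel of the
    previous map. *)
Lemma differentials_exist Z (d0 : 'M[S]_(r 1, r 0)) :
  submodule Z -> no_standard Z -> (forall j, Z (row j d0)) -> leading_terms d0 ->
  exists2 d, differentials Z d & d 0%N = d0.
Proof.
move=> sZ nZ Zd0 ld0.
pose step k := {d : 'M[S]_(r k.+1, r k) | leading_terms d /\
   exists2 Z' : 'rV[S]_(r k) -> Prop, submodule Z' /\ no_standard Z' & forall j, Z' (row j d)}.
have next k (s : step k) : {s' : step k.+1 | sval s' *m sval s = 0}.
  apply: constructive_indefinite_description; case: s => d [ld [Z' [sZ' nZ'] Z'd]] /=.
  have [d' dd' ld'] := lift_leading ld sZ' nZ' Z'd.
  have P : leading_terms d' /\ exists2 Z' : 'rV[S]_(r k.+1) -> Prop,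
      submodule Z' /\ no_standard Z' & forall j, Z' (row j d').
    split=> //; exists (fun z : 'rV[S]_(r k.+1) => z *m d = 0).
      by split; [apply: submodule_ker | apply: no_standard_ker].
    by move=> j; rewrite -row_mul dd' row0.
  by exists (exist _ d' P).
have P0 : leading_terms d0 /\ exists2 Z' : 'rV[S]_(r 0) -> Prop,
    submodule Z' /\ no_standard Z' & forall j, Z' (row j d0).
  by split=> //; exists Z.
pose seq_d := fix F k : step k :=
  if k is k'.+1 then sval (next k' (F k')) else exist _ d0 P0.
exists (fun k => sval (seq_d k)) => //; split=> // k /=.
  by case: (next k (seq_d k)).
by case: (seq_d k) => d [].
Qed.

End Frame.

(** * Words of vertex sets *)

Section Words.
Variables (n : nat) (A : 'M[nat]_n.+1).
Hypothesis A_sym : forall i j, A i j = A j i.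
Local Notation V := 'I_n.+1.
Local Notation root := (@ord_max n).
Local Notation adj := (adjacent A).
Local Notation conn := (connected_on A).
Implicit Types (U W X Y C : {set V}) (s w : seq {set V}).

Lemma adjacent_sym : ssrbool.symmetric adj.
Proof. by move=> i j; rewrite /adjacent /= eq_sym A_sym. Qed.

Lemma closed_in_component (U C : {set V}) x y :
  (forall a b, a \in C -> b \in U -> b \notin C -> ~~ adj a b) ->
  connect [rel a b | [&& a \in U, b \in U & adj a b]] x y -> (x \in C) = (y \in C).
Proof.
move=> nC; apply: closed_connect => a b /and3P[aU bU ab].
have [aC|aC] := boolP (a \in C); have [bC|bC] //:= boolP (b \in C).
  by have := nC _ _ aC bU bC; rewrite ab.
by have := nC _ _ bC aU aC; rewrite adjacent_sym ab.
Qed.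

(** Edge cuts replace paths in the arguments below. For the converse, the cut condition is applied
    to the set reached from one vertex. *)
Lemma connected_cut U : reflect
  (forall C, C \subset U -> C != set0 -> C != U ->
     exists x y, [/\ x \in C, y \in U, y \notin C & adj x y]) (conn U).
Proof.
apply: (iffP idP) => [cU C CU /set0Pn[x xC] CnU|cutU].
  have /properP[_ [y yU yC]] : C \proper U by rewrite properEneq CnU.
  case: (pickP [pred p : V * V | [&& p.1 \in C, p.2 \in U, p.2 \notin C & adj p.1 p.2]]).
    by move=> [a b] /= /and4P[? ? ? ?]; exists a, b.
  move=> none; suff : (x \in C) = (y \in C) by rewrite xC (negPf yC).
  apply: (@closed_in_component U) => [a b aC bU bC|].
    by apply/negP => ab; have := none (a, b); rewrite /= aC bU bC ab.
  move: cU => /forallP/(_ x); rewrite (subsetP CU) //= => /forallP/(_ y).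
  by rewrite yU.
apply/forallP => i; apply/implyP => iU; apply/forallP => j; apply/implyP => jU.
pose C := [set y in U | connect [rel a b | [&& a \in U, b \in U & adj a b]] i y].
have CU : C \subset U by apply/subsetP => y; rewrite inE => /andP[].
have iC : i \in C by rewrite inE iU connect0.
have [eC|nC] := eqVneq C U.
  by move: jU; rewrite -{1}eC inE => /andP[].
have [|//|x [y [xC yU + xy]]] := cutU C CU; first by apply/set0Pn; exists i.
move: xC; rewrite !inE yU => /andP[xU ix] /=.
move=> /negP[]; apply: connect_trans ix (connect1 _).
by rewrite /= xU yU.
Qed.

Lemma component U x : x \in U -> exists C,
  [/\ C \subset U, x \in C, conn C
    & forall a b, a \in C -> b \in U -> adj a b -> b \in C].
Proof.
move=> xU; pose e := [rel a b | [&& a \in U, b \in U & adj a b]].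
pose C := [set y in U | connect e x y]; exists C.
have CU : C \subset U by apply/subsetP => y; rewrite inE => /andP[].
have clC a b : a \in C -> b \in U -> adj a b -> b \in C.
  rewrite !inE => /andP[aU xa] bU ab; rewrite bU.
  by apply: connect_trans xa (connect1 _); rewrite /= aU bU.
split=> //; first by rewrite inE xU connect0.
apply/connected_cut => D DC D0 DnC.
case: (pickP [pred p : V * V | [&& p.1 \in D, p.2 \in C, p.2 \notin D & adj p.1 p.2]]).
  by move=> [a b] /= /and4P[? ? ? ?]; exists a, b.
move=> none.
have inD y : y \in C -> (x \in D) = (y \in D).
  rewrite inE => /andP[_]; apply: closed_in_component => a b aD bU bD.
  apply/negP => ab; have := none (a, b).
  by rewrite /= aD bD ab (clC a) // (subsetP DC).
have [xD|xD] := boolP (x \in D).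
  case/eqP: DnC; apply/eqP; rewrite eqEsubset DC; apply/subsetP => y /inD <-.
  exact: xD.
case/set0Pn: D0 => y yD; move: (inD y (subsetP DC _ yD)).
by rewrite yD (negPf xD).
Qed.

Lemma connected_setU X Y x y : conn X -> conn Y -> x \in X -> y \in Y ->
  adj x y -> conn (X :|: Y).
Proof.
move=> /connected_cut cX /connected_cut cY xX yY xy.
apply/connected_cut => C CU C0 CnU.
have [XC|XC] := eqVneq (C :&: X) X.
  have [YC|YC] := eqVneq (C :&: Y) Y.
    case/eqP: CnU; apply/eqP; rewrite eqEsubset CU subUset.
    by rewrite -{1}XC -{1}YC !subsetIl.
  have xC : x \in C by move: xX; rewrite -XC inE => /andP[].
  have [YC0|YC0] := eqVneq (C :&: Y) set0.
    exists x, y; split=> //; first by rewrite inE yY orbT.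
    by apply/negP => yC; move/setP/(_ y): YC0; rewrite !inE yC yY.
  have [a [b [aC bY bC ab]]] := cY _ (subsetIr _ _) YC0 YC.
  exists a, b; move: aC bC; rewrite !inE bY andbT orbT => /andP[-> _] ->.
  by rewrite ab.
have [XC0|XC0] := eqVneq (C :&: X) set0; last first.
  have [a [b [aC bX bC ab]]] := cX _ (subsetIr _ _) XC0 XC.
  exists a, b; move: aC bC; rewrite !inE bX andbT => /andP[-> _] ->.
  by rewrite ab.
have xC : x \notin C.
  by apply/negP => xC; move/setP/(_ x): XC0; rewrite !inE xC xX.
have YC0 : C :&: Y != set0.
  case/set0Pn: C0 => a aC; apply/set0Pn; exists a; rewrite inE aC.
  have := subsetP CU a aC; rewrite inE => /orP[aX|//].
  by move/setP/(_ a): XC0; rewrite !inE aC aX.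
have [YC|YC] := eqVneq (C :&: Y) Y.
  exists y, x; rewrite !inE xX adjacent_sym xy xC; split=> //.
  by move: yY; rewrite -YC inE => /andP[].
have [a [b [aC bY bC ab]]] := cY _ (subsetIr _ _) YC0 YC.
exists a, b; move: aC bC; rewrite !inE bY andbT orbT => /andP[-> _] ->.
by rewrite ab.
Qed.

(** [C] is a union of components of [X :\: Y], so the other components stay attached to [Y] when [C]
    is deleted. *)
Lemma connected_remove_component X Y C y : conn X -> conn Y -> Y \subset X ->
  y \in Y -> C \subset X :\: Y ->
  (forall a b, a \in C -> b \in X :\: Y -> adj a b -> b \in C) -> conn (X :\: C).
Proof.
move=> /connected_cut cX /connected_cut cY YX yY CXY clC.
(* For a cut disjoint from [Y], the edge that leaves it inside [X] cannot end in [C]. *)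
have main (D : {set V}) : D \subset X :\: C -> D != set0 -> D :&: Y = set0 ->
    exists x z, [/\ x \in D, z \in X :\: C, z \notin D & adj x z].
  move=> DXC D0 DY; have DX : D \subset X by apply: subset_trans DXC (subsetDl _ _).
  have DnX : D != X.
    apply/eqP => DX'; move/setP/(_ y): DY.
    by rewrite DX' !inE yY (subsetP YX).
  have [a [b [aD bX bD ab]]] := cX D DX D0 DnX.
  exists a, b; rewrite inE bX andbT; split=> //; apply/negP => bC.
  have : a \in C.
    apply: clC bC _ _; last by rewrite adjacent_sym.
    rewrite inE (subsetP DX) // andbT; apply/negP => aY.
    by move/setP/(_ a): DY; rewrite !inE aD aY.
  by have := subsetP DXC _ aD; rewrite inE => /andP[/negPf ->].
apply/connected_cut => D DXC D0 DnXC.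
have YXC : Y \subset X :\: C.
  apply/subsetP => z zY; rewrite inE (subsetP YX) // andbT; apply/negP => zC.
  by have := subsetP CXY _ zC; rewrite inE zY.
have [DY|DY] := eqVneq (D :&: Y) set0; first exact: main.
have [DY'|DY'] := eqVneq (D :&: Y) Y; last first.
  have [a [b [aC bY bC ab]]] := cY _ (subsetIr _ _) DY DY'.
  exists a, b; move: aC bC; rewrite inE (subsetP YXC _ bY) => /andP[-> _].
  by rewrite inE bY andbT ab => ->.
(* A cut containing [Y] is handled through its complement, which avoids [Y]. *)
have [| | |a [b [aD bXC bD ab]]] := main ((X :\: C) :\: D).
- exact: subsetDl.
- rewrite setD_eq0; apply: contra DnXC => h.
  by rewrite eqEsubset DXC.
- apply/setP => z; rewrite !inE; apply/negP => /andP[/andP[zD _] zY].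
  by move: zY zD; rewrite -DY' inE => /andP[->].
exists b, a; move: aD bD bXC; rewrite !inE => /and3P[-> -> ->] /=.
rewrite adjacent_sym ab negb_and negbK => /orP[->//|h /andP[bC bX]].
by rewrite bC bX in h.
Qed.

Definition separated W X : bool := [forall x in W, forall y in X, ~~ adj x y].

Lemma separatedP W X : reflect (forall x y, x \in W -> y \in X -> ~~ adj x y)
  (separated W X).
Proof.
apply: (iffP idP) => [/forallP h x y xW yX|h].
  by move: (h x); rewrite xW => /forallP/(_ y); rewrite yX.
apply/forallP => x; apply/implyP => xW; apply/forallP => y; apply/implyP => yX.
exact: h.
Qed.

(** A linear order refining reverse inclusion: the size of the complement is the leading digit, and
    the enumeration index breaks ties. *)
Definition set_code W : nat := ((n.+1 - #|W|) * #|{set V}| + enum_rank W)%N.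

Lemma set_code_inj : injective set_code.
Proof.
move=> W X /(congr1 (modn^~ #|{set V}|)); rewrite !modnMDl !modn_small //.
by move/val_inj/enum_rank_inj.
Qed.

Lemma set_code_lt W X : W \proper X -> (set_code X < set_code W)%N.
Proof.
move=> /proper_card lt; rewrite /set_code.
have le Y : (#|Y| <= n.+1)%N by rewrite -[X in (_ <= X)%N]card_ord max_card.
have h : (n.+1 - #|X| < n.+1 - #|W|)%N by have := le X; have := le W; lia.
apply: (@leq_trans ((n.+1 - #|X|).+1 * #|{set V}|)%N).
  by rewrite mulSn addnC ltn_add2r ltn_ord.
by apply: leq_trans (leq_addr _ _); rewrite leq_mul2r h orbT.
Qed.

Definition code_bound : nat := (n.+2 * #|{set V}|)%N.

Lemma set_code_bound W : (set_code W < code_bound)%N.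
Proof.
rewrite /set_code /code_bound mulSn addnC -addSn.
by rewrite leq_add // ?ltn_ord // leq_mul2r leq_subr orbT.
Qed.

(* A word lists disjoint sets of vertices, the head being removed last.       *)
Definition rest s : {set V} := foldr (fun W X => X :\: W) setT s.

(* Lexicographic normal form under commutation of separated letters: [W] may  *)
(* not move before a letter with a larger code.                                *)
Fixpoint appendable s W : bool :=
  if s is X :: s' then
    separated W X ==> ((set_code W < set_code X)%N && appendable s' W)
  else true.

Fixpoint word s : bool :=
  if s is W :: s' then
    [&& word s', W != set0, W \subset rest s', root \notin W, conn W,
        conn (rest s' :\: W) & appendable s' W]
  else true.

(** * Degrees of words and the colon conditions *)

Section Degrees.
Variables (N : nat) (src : 'I_N -> V) (b : 'I_N -> V -> nat).
Hypothesis b_adj : forall z u, u != src z -> (0 < b z u)%N -> adj (src z) u.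

(** The variable [z] sits at the vertex [src z], with exponent [b z u] for the edges to [u]. The
    vertex ring is the case [src = id], [b = A]; the edge ring has one variable per ordered pair. *)
Definition cut_degree W X : 'X_{1..N} :=
  [multinom (if src z \in W then \sum_(u in X) b z u else 0)%N | z < N].

Fixpoint degree_at s (z : 'I_N) : nat :=
  if s is W :: s' then
    (degree_at s' z + if src z \in W then \sum_(u in rest s' :\: W) b z u else 0)%N
  else 0%N.

Definition word_degree s : 'X_{1..N} := [multinom degree_at s z | z < N].

Lemma word_degreeE s z : word_degree s z = degree_at s z.
Proof. exact: mnmE. Qed.

Lemma cut_degreeE W X z : cut_degree W X z =
  if src z \in W then (\sum_(u in X) b z u)%N else 0%N.
Proof. exact: mnmE. Qed.

Lemma cut_sum_sub z X Y : src z \notin X ->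
  (forall u, u \in X -> adj (src z) u -> u \in Y) ->
  (\sum_(u in X) b z u <= \sum_(u in Y) b z u)%N.
Proof.
move=> zX h; rewrite big_mkcond [X in (_ <= X)%N]big_mkcond; apply: leq_sum => u _.
case: ifP => // uX; case: ifP => // uY; rewrite leqn0 -[_ == _]negbK -lt0n.
apply/negP => bp; have : u \in Y.
  by apply: h => //; apply: b_adj => //; apply: contraNneq zX => <-.
by rewrite uY.
Qed.

Lemma word_connected s : conn setT -> word s -> root \in rest s /\ conn (rest s).
Proof.
move=> cT; elim: s => [|W s IH] //=; first by rewrite inE.
case/and3P=> /IH[rs _] _ /and5P[_ nW _ cW _].
by rewrite inE nW rs.
Qed.

(** [Y] is the component of the root outside [S], and [W] a component of the complement of [Y]
    meeting [S]. Edges leaving [W] end in [Y] and hence start in [S], so the degree of [S] already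
    counts them. *)
Lemma cut_divides S M : conn setT -> S != set0 -> root \notin S ->
  (cut_degree S (~: S) <= M)%MM ->
  exists W, word [:: W] /\ (word_degree [:: W] <= M)%MM.
Proof.
move=> cT /set0Pn[x xS] rS SM.
have [|Y [YS rY cY clY]] := @component (~: S) root; first by rewrite inE.
have xY : x \in ~: Y by rewrite inE; apply: contraL xS => /(subsetP YS); rewrite inE.
have [W [WY xW cW clW]] := component xY.
have rW : root \notin W by apply: contraL rY => /(subsetP WY); rewrite inE.
exists W; split.
  rewrite /= subsetT rW cW andbT; apply/andP; split; first by apply/set0Pn; exists x.
  apply: (connected_remove_component cT cY (subsetT _) rY); rewrite setTD //.
apply/mnm_lepP => z; rewrite word_degreeE /= add0n.
case: ifP => // zW; move/mnm_lepP/(_ z): SM; rewrite cut_degreeE.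
have zY : src z \notin Y by move: (subsetP WY _ zW); rewrite inE.
have toY u : u \in setT :\: W -> adj (src z) u -> u \in Y.
  rewrite !inE andbT => uW zu; apply: contraNT uW => uY.
  by apply: clW zu => //; rewrite inE.
have zn : src z \notin setT :\: W by rewrite inE zW.
case: ifP => [zS|zS] le.
  apply: leq_trans le; apply: cut_sum_sub => // u uW zu.
  by apply: (subsetP YS); apply: toY.
rewrite big1 // => u uW; apply/eqP; rewrite -leqn0 leqNgt; apply/negP => bp.
have zu : adj (src z) u by apply: b_adj => //; apply: contraNneq zn => <-.
have uY := toY _ uW zu; case/negP: zY; apply: clY uY _ _.
  by rewrite inE zS.
by rewrite adjacent_sym.
Qed.

Lemma appendable_sub s W X : W \subset X -> (set_code X <= set_code W)%N ->
  appendable s W -> appendable s X.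
Proof.
move=> WX le; elim: s => //= P s IH aW; apply/implyP => /separatedP sep.
have sW : separated W P by apply/separatedP => x y /(subsetP WX); apply: sep.
move: aW; rewrite sW => /andP[lt /IH ->]; rewrite andbT.
exact: leq_ltn_trans lt.
Qed.

(* Moving [W'] in front of [W], or merging both letters.                       *)
Lemma word_colon_left W W' s M : conn setT -> word (W' :: W :: s) ->
  (word_degree (W' :: W :: s) <= M)%MM ->
  exists X, [/\ word (X :: s), (word_degree (X :: s) <= M)%MM
              & (set_code X < set_code W)%N].
Proof.
move=> cT wW' /mnm_lepP dM; have ws : word s by case/and3P: wW' => /and3P[].
have [rU cU] := word_connected cT ws.
move: wW' => /= /and3P[/and3P[_ W0 /and5P[WU rW cW cX aW]] W'0].
case/and5P=> W'X rW' cW' cY.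
have W'U : W' \subset rest s := subset_trans W'X (subsetDl _ _).
have disj v : v \in W' -> v \notin W by move/(subsetP W'X); rewrite inE => /andP[].
case/set0Pn: (W0) => w0 w0W; case/set0Pn: (W'0) => w1 w1W'.
have [/separatedP sep /=|nsep _] := boolP (separated W' W).
  move=> /andP[lt aW']; exists W'; split=> //.
    rewrite /= ws W'0 W'U rW' cW' aW' /= andbT.
    (* An edge leaves [W] inside [rest s]. It ends outside [W'], which is separated from [W], and so
       attaches [W] to what remains. *)
    have [||x [y [xW yU yW xy]]] := connected_cut _ cU W WU.
    - by apply/set0Pn; exists w0.
    - by apply: contraNneq rW => ->.
    have -> : rest s :\: W' = W :|: (rest s :\: W :\: W').
      apply/setP=> v; rewrite !inE; have [vW|vW] //= := boolP (v \in W).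
      rewrite (subsetP WU) // andbT; apply/negP => /disj.
      by rewrite vW.
    apply: (connected_setU cW cY xW _ xy); rewrite !inE yU yW !andbT.
    by apply/negP => yW'; have := sep _ _ yW' xW; rewrite adjacent_sym xy.
  apply/mnm_lepP => z; have := dM z; rewrite !word_degreeE /=.
  case: (boolP (src z \in W')) => [zW'|_]; last first.
    by rewrite !addn0 => le; apply: leq_trans le; apply: leq_addr.
  rewrite (negPf (disj _ zW')) addn0; apply: leq_trans; rewrite leq_add2l.
  apply: cut_sum_sub; first by rewrite inE zW'.
  move=> u; rewrite !inE => /andP[-> ->] zu; rewrite andbT.
  by apply/negP => uW; have := sep _ _ zW' uW; rewrite zu.
(* Adjacent letters are merged; the union is strictly larger than [W], so its code is smaller. *)
have [x [y [xW' yW xy]]] : exists x y, [/\ x \in W', y \in W & adj x y].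
  case/forallPn: nsep => x; rewrite negb_imply => /andP[xW'] /forallPn[y].
  by rewrite negb_imply negbK => /andP[yW xy]; exists x, y.
have prop : W \proper W' :|: W.
  rewrite properE subsetUr; apply/subsetPn; exists w1; rewrite ?inE ?w1W' //.
  exact: disj.
have lt := set_code_lt prop.
have eX : rest s :\: (W' :|: W) = rest s :\: W :\: W'.
  by rewrite setDDl setUC.
exists (W' :|: W); split=> //.
  rewrite /= ws eX cY (connected_setU cW' cW xW' yW xy).
  rewrite (appendable_sub (proper_sub prop) (ltnW lt) aW) /= !andbT.
  rewrite subUset W'U WU inE negb_or rW rW' !andbT.
  by apply/set0Pn; exists w1; rewrite inE w1W'.
apply/mnm_lepP => z; have := dM z.
rewrite !word_degreeE /= eX.
rewrite inE; case: (boolP (src z \in W')) => [zW'|zW'] /=.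
  by rewrite (negPf (disj _ zW')) addn0.
case: ifP => zW; rewrite !addn0 //; apply: leq_trans.
rewrite leq_add2l; apply: cut_sum_sub; first by rewrite !inE zW !andbF.
by move=> u; rewrite !inE => /andP[_ ->].
Qed.

(** Take [x] in [X] outside [W], the root component [Y] of [U :\: (X :|: W)], and the component [W']
    of [x] in [U :\: W :\: Y]. Edges from [W'] to the remaining set end in [Y] and start in [X], so
    the degree of [X] bounds their contribution. *)
Lemma word_colon_right W X s M : conn setT ->
  word (W :: s) -> (word_degree (W :: s) <= M)%MM ->
  word (X :: s) -> (word_degree (X :: s) <= M)%MM -> (set_code X < set_code W)%N ->
  exists W', word (W' :: W :: s) /\ (word_degree (W' :: W :: s) <= M)%MM.
Proof.
move=> cT wW /mnm_lepP dW wX /mnm_lepP dX lt.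
have ws : word s by case/andP: wW.
have [rU cU] := word_connected cT ws; set U := rest s in rU cU.
move: (wW) (wX) => /= /and3P[_ W0 /and5P[WU rW cW cUW aW]].
case/and3P=> _ X0 /and5P[XU rX cX cUX aX]; rewrite -/U in WU XU cUW cUX.
have /subsetPn[x xX xW] : ~~ (X \subset W).
  apply/negP; rewrite subEproper => /orP[/eqP e|/set_code_lt].
    by rewrite e ltnn in lt.
  by rewrite ltnNge ltnW.
pose Q := U :\: (X :|: W).
have [|Y [YQ rY cY clY]] := @component Q root.
  by rewrite !inE negb_or rX rW.
have YU : Y \subset U :\: W.
  by apply: subset_trans YQ _; rewrite setDS // subsetUr.
have xT : x \in U :\: W :\: Y.
  rewrite !inE xW (subsetP XU) // !andbT; apply/negP => /(subsetP YQ).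
  by rewrite !inE xX.
have [W' [W'T xW' cW' clW']] := component xT.
have W'P v : v \in W' -> [/\ v \notin Y, v \notin W & v \in U].
  by move/(subsetP W'T); rewrite !inE => /and3P[].
have toY a u : a \in W' -> u \in U :\: W :\: W' -> adj a u -> u \in Y.
  move=> aW'; rewrite !inE => /and3P[uW' uW uU] au.
  apply: contraNT uW' => uY; apply: clW' au => //.
  by rewrite !inE uY uW.
have cY' : conn (U :\: W :\: W').
  by apply: connected_remove_component YU rY W'T _.
have rW' : root \notin W' by apply/negP => /W'P[]; rewrite rY.
exists W'; split; last first.
  apply/mnm_lepP => z; have := dW z; have := dX z.
  rewrite !word_degreeE /= -/U.
  case: (boolP (src z \in W')) (@toY (src z)) => [zW' {}toY|_ _ _]; last by rewrite addn0.
  have [zY zW zU] := W'P _ zW'; rewrite (negPf zW) addn0.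
  have zn : src z \notin U :\: W :\: W' by rewrite !inE zW'.
  case: (boolP (src z \in X)) => [zX leX _|zX _ le].
    apply: leq_trans leX; rewrite leq_add2l; apply: cut_sum_sub => // u uY zu.
    have := subsetP YQ _ (toY _ isT uY zu).
    by rewrite !inE negb_or => /andP[/andP[-> _] ->].
  rewrite [X in (_ + X)%N]big1 ?addn0 // => u uW; apply/eqP; rewrite -leqn0 leqNgt.
  apply/negP => bp.
  have zu : adj (src z) u by apply: b_adj => //; apply: contraNneq zn => <-.
  have uY := toY _ isT uW zu; case/negP: zY; apply: clY uY _ _.
    by rewrite !inE (negPf zX) (negPf zW) zU.
  by rewrite adjacent_sym.
have W'0 : W' != set0 by apply/set0Pn; exists x.
have W'U : W' \subset U :\: W by apply: subset_trans W'T (subsetDl _ _).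
change ([&& word (W :: s), W' != set0, W' \subset U :\: W, root \notin W', conn W',
  conn (U :\: W :\: W') & appendable (W :: s) W']).
(* Appendability remains. If [W'] is separated from [W], connectedness of [X] and of [U :\: X]
   forces [W' = X], which has smaller code and is appendable to [s]. *)
rewrite wW W'0 W'U rW' cW' cY' /=; apply/implyP => /separatedP sep.
have clX a u : a \in W' -> u \in X -> adj a u -> u \in W'.
  move=> aW' uX au; apply: clW' (au) => //; rewrite !inE (subsetP XU _ uX) andbT.
  apply/andP; split; first by apply/negP => /(subsetP YQ); rewrite !inE uX.
  by apply/negP => uW; have := sep _ _ aW' uW; rewrite au.
have XW' : X \subset W'.
  apply/setIidPl/eqP; rewrite setIC; apply/negPn/negP => ne.
  have [|//|a [u []]] := connected_cut _ cX (W' :&: X) (subsetIr _ _).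
    by apply/set0Pn; exists x; rewrite inE xX xW'.
  rewrite !inE => /andP[aW' aX1] uX; rewrite uX andbT => uW' au.
  by rewrite (clX a) in uW'.
suff -> : W' = X by rewrite lt.
apply/eqP; rewrite eqEsubset XW' andbT -setD_eq0; apply/negPn/negP => ne.
have DU : W' :\: X \subset U :\: X.
  by apply: setSD; apply: subset_trans W'U (subsetDl _ _).
have [|a [u []]] := connected_cut _ cUX _ DU ne.
  apply/negP => /eqP/setP/(_ root).
  by rewrite !inE (negPf rW') rX rU.
rewrite !inE => /andP[naX aW'] /andP[uX uU]; rewrite uX /= => uW' au.
have uW : u \notin W by apply/negP => uW; have := sep _ _ aW' uW; rewrite au.
have [uY|uY] := boolP (u \in Y).
  have [+ naW aU] := W'P _ aW'; case/negP; apply: clY uY _ _.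
    by rewrite !inE negb_or naX naW.
  by rewrite adjacent_sym.
by case/negP: uW'; apply: clW' au => //; rewrite !inE uY uW.
Qed.

End Degrees.
End Words.

(** * Words and acyclic orientations *)

Section WordParts.
Variables (n : nat) (A : 'M[nat]_n.+1).
Hypothesis A_sym : forall i j, A i j = A j i.
Local Notation V := 'I_n.+1.
Local Notation root := (@ord_max n).
Local Notation adj := (adjacent A).
Local Notation conn := (connected_on A).
Hypothesis connT : conn setT.
Implicit Types (U W X Y C P Q : {set V}) (s t w : seq {set V}).

Definition parts s : seq {set V} := rest s :: s.

Lemma rest_disjoint s P v : P \in s -> v \in P -> v \notin rest s.
Proof.
elim: s => //= W s IH; rewrite !inE negb_and negbK => /orP[/eqP -> ->//|Ps vP].
by rewrite IH ?orbT.
Qed.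

Lemma parts_cover s v : exists2 P, P \in parts s & v \in P.
Proof.
suff H : v \notin rest s -> exists2 P, P \in s & v \in P.
  have [vr|/H[P Ps vP]] := boolP (v \in rest s).
    by exists (rest s) => //; rewrite mem_head.
  by exists P => //; rewrite inE Ps orbT.
elim: s => [|W s IH] /=; first by rewrite inE.
rewrite inE negb_and negbK => /orP[vW|/IH[P Ps vP]].
  by exists W => //; rewrite mem_head.
by exists P => //; rewrite inE Ps orbT.
Qed.

Lemma parts_disjoint s P Q v : word A s -> P \in parts s -> Q \in parts s ->
  v \in P -> v \in Q -> P = Q.
Proof.
have main s' : word A s' -> forall P' Q', P' \in s' -> Q' \in s' ->
    v \in P' -> v \in Q' -> P' = Q'.
  elim: s' => //= W s' IH /and3P[ws _ /andP[/subsetP WU _]] P' Q'.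
  rewrite !inE => /orP[/eqP->|Ps] /orP[/eqP->|Qs] // vP vQ.
  - by have := rest_disjoint Qs vQ; rewrite WU.
  - by have := rest_disjoint Ps vP; rewrite WU.
  exact: IH.
move=> ws; rewrite !inE => /orP[/eqP->|Ps] /orP[/eqP->|Qs] // vP vQ.
- by have := rest_disjoint Qs vQ; rewrite vP.
- by have := rest_disjoint Ps vP; rewrite vQ.
exact: main ws _ _ Ps Qs vP vQ.
Qed.

Lemma parts_neq0 s P : word A s -> P \in parts s -> P != set0.
Proof.
move=> ws; rewrite inE => /orP[/eqP->|].
  by apply/set0Pn; exists root; case: (word_connected connT ws).
elim: s ws => //= W s IH /and3P[ws W0 _].
by rewrite inE => /orP[/eqP->|/IH->].
Qed.

Lemma parts_uniq s : word A s -> uniq (parts s).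
Proof.
move=> ws /=; apply/andP; split.
  apply/negP => rs; have := @rest_disjoint _ _ root rs.
  by case: (word_connected connT ws) => -> _ /(_ isT).
elim: s ws => //= W s IH /and3P[ws /set0Pn[v vW] /andP[/subsetP WU _]].
rewrite IH // andbT; apply/negP => Ws.
by have := rest_disjoint Ws vW; rewrite WU.
Qed.

Lemma parts_connected s P : word A s -> P \in parts s -> conn P.
Proof.
move=> ws; rewrite inE => /orP[/eqP->|].
  by case: (word_connected connT ws).
elim: s ws => //= W s IH /and3P[ws _ /and5P[_ _ cW _ _]].
by rewrite inE => /orP[/eqP->|/IH->].
Qed.

Lemma parts_partition s : word A s -> partition [set:: parts s] setT.
Proof.
move=> ws; apply/and3P; split.
- apply/eqP/setP => v; rewrite [RHS]inE; apply/bigcupP.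
  by have [P Ps vP] := parts_cover s v; exists P; rewrite // inE.
- apply/trivIsetP => P Q; rewrite !inE => Ps Qs; apply: contraR.
  by case/pred0Pn => v /andP[vP vQ]; rewrite (parts_disjoint ws _ _ vP vQ) ?inE.
by rewrite inE; apply/negP => /(parts_neq0 ws); rewrite eqxx.
Qed.

Lemma card_parts s : word A s -> #|[set:: parts s]| = (size s).+1.
Proof. by move=> ws; rewrite cardsE; apply/card_uniqP/parts_uniq. Qed.

Definition same_part s v u : bool := has (fun P => (v \in P) && (u \in P)) (parts s).

Lemma same_partP s v u P : word A s -> P \in parts s -> v \in P ->
  same_part s v u = (u \in P).
Proof.
move=> ws Ps vP; apply/hasP/idP => [[Q Qs /andP[vQ uQ]]|uP].
  by rewrite (parts_disjoint ws Ps Qs vP vQ).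
by exists P; rewrite ?vP.
Qed.

(* The parts are the components left after removing the edges between parts. *)
Lemma size_eq_same_part s t : word A s -> word A t ->
  (forall v u, adj v u -> same_part s v u = same_part t v u) -> size s = size t.
Proof.
have main s' t' v u : word A s' -> word A t' ->
    (forall v u, adj v u -> same_part s' v u = same_part t' v u) ->
    same_part s' v u -> same_part t' v u.
  move=> ws wt st /hasP[P Ps /andP[vP uP]].
  have [Q Qt vQ] := parts_cover t' v; rewrite (same_partP _ wt Qt vQ).
  have cP := parts_connected ws Ps.
  suff /setIidPl/setP/(_ u) : P \subset Q by rewrite inE uP.
  apply/setIidPl/eqP/negPn/negP => ne.
  have [|//|x [y []]] := connected_cut A_sym _ cP (P :&: Q) (subsetIl _ _).
    by apply/set0Pn; exists v; rewrite inE vP.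
  rewrite !inE => /andP[xP xQ] yP; rewrite yP /= => yQ xy.
  have := st _ _ xy; rewrite (same_partP _ ws Ps xP) yP.
  by rewrite (same_partP _ wt Qt xQ) (negPf yQ).
move=> ws wt st.
have E v u : same_part s v u = same_part t v u.
  by apply/idP/idP; apply: main => // v' u' /st.
have inc s' t' : word A s' -> word A t' -> same_part s' =2 same_part t' ->
    {subset parts s' <= parts t'}.
  move=> ws' wt' e P Ps; have /set0Pn[v vP] := parts_neq0 ws' Ps.
  have [Q Qt vQ] := parts_cover t' v; suff -> : P = Q by [].
  by apply/setP=> u; rewrite -(same_partP u ws' Ps vP) -(same_partP u wt' Qt vQ).
apply/eqP; rewrite -eqSS -(card_parts ws) -(card_parts wt).
by apply/eqP/eq_card => P; rewrite !inE -!in_cons; apply/idP/idP; apply: inc => // v u.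
Qed.

Lemma part_adjacentP U W : reflect (U != W /\ exists x y, [/\ x \in U, y \in W & 0 < A x y])
  (part_adjacent A U W).
Proof.
apply: (iffP andP) => [[ne]|[ne [x [y [xU yW xy]]]]].
  rewrite lt0n sum_nat_eq0 negb_forall => /existsP[x].
  rewrite negb_imply sum_nat_eq0 negb_forall => /andP[xU /existsP[y]].
  by rewrite negb_imply -lt0n => /andP[yW xy]; split=> //; exists x, y.
split=> //; rewrite (bigD1 x) //= (bigD1 y) //=.
by rewrite -addnA ltn_addr.
Qed.

Lemma part_adjacent_sym U W : part_adjacent A U W = part_adjacent A W U.
Proof.
have h U' W' : part_adjacent A U' W' -> part_adjacent A W' U'.
  move=> /part_adjacentP[ne [x [y [? ? ?]]]]; apply/part_adjacentP.
  by rewrite eq_sym; split=> //; exists y, x; rewrite A_sym.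
by apply/idP/idP; apply: h.
Qed.

Lemma separated_part_adjacent s U W : word A s -> U \in parts s -> W \in parts s ->
  U != W -> separated A U W = ~~ part_adjacent A U W.
Proof.
move=> ws Us Ws ne; apply/separatedP/negP => [sep /part_adjacentP[_ [x [y [xU yW xy]]]]|nadj].
  have := sep x y xU yW; rewrite /adjacent /= xy andbT negbK => /eqP exy.
  by case/eqP: ne; apply: parts_disjoint ws Us Ws xU _; rewrite exy.
move=> x y xU yW; apply/negP => /andP[_ xy].
by apply/nadj/part_adjacentP; split=> //; exists x, y.
Qed.

(** In [parts] the root part comes first, followed by the letters from last removed to first
    removed; a smaller index thus means later removal. *)
Definition word_orientation s : {set {set V} * {set V}} :=
  [set p | [&& p.1 \in parts s, p.2 \in parts s, index p.2 (parts s) < index p.1 (parts s)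
             & part_adjacent A p.1 p.2]].

(** Pairing partition and orientation turns the sum of the [alpha] into one cardinality, to be
    matched with words. *)
Definition root_oriented (k : nat) :=
  [set p : {set {set V}} * {set {set V} * {set V}} |
    [&& p.1 \in connected_partitions A k.+1, orientation p.1 (part_adjacent A) p.2,
        acyclic p.2 & sinks p.1 p.2 == [set pblock p.1 root]]].

Lemma card_root_oriented k :
  #|root_oriented k| = \sum_(Pi in connected_partitions A k.+1) alpha A Pi.
Proof.
rewrite -sum1_card /alpha.
under [RHS]eq_bigr do rewrite -sum1_card.
rewrite pair_big_dep /=; apply: eq_bigl => -[Pi D] /=.
by rewrite !inE.
Qed.

Lemma pblock_parts s : word A s -> pblock [set:: parts s] root = rest s.
Proof.
move=> ws; apply: def_pblock; last by case: (word_connected connT ws).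
  by case/and3P: (parts_partition ws).
by rewrite inE mem_head.
Qed.

Lemma word_catr s1 s2 : word A (s1 ++ s2) -> word A s2.
Proof. by elim: s1 => //= W s1 IH /andP[/IH]. Qed.

Lemma index_before (s1 s2 : seq {set V}) x y : uniq (s1 ++ s2) ->
  x \in s1 -> y \in s2 -> index x (s1 ++ s2) < index y (s1 ++ s2).
Proof.
rewrite cat_uniq => /and3P[_ /hasPn h _] xs ys.
rewrite !index_cat xs (negPf (h _ ys)); apply: leq_trans (leq_addr _ _).
by rewrite index_mem.
Qed.

(** Indices decrease along directed paths, which excludes cycles. A letter is not a sink: the set
    from which it is removed is connected, so an edge leads from it to a part removed later. *)
Lemma word_root_oriented s : word A s ->
  ([set:: parts s], word_orientation s) \in root_oriented (size s).
Proof.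
move=> ws; rewrite inE /=; apply/and4P; split.
- rewrite inE parts_partition // card_parts // eqxx /=.
  by apply/forallP=> P; apply/implyP; rewrite inE; apply: parts_connected.
- apply/forallP=> P; apply/forallP=> Q; rewrite !inE /= -!in_cons -/(parts s).
  case: ifP => [/and3P[Ps Qs PQ]|h]; last first.
    by apply: contraFN h => /and4P[-> -> _ ->].
  rewrite Ps Qs PQ part_adjacent_sym PQ /= !andbT.
  have : index P (parts s) != index Q (parts s).
    by case/part_adjacentP: PQ => ne _; apply: contra_neq ne; apply: index_inj.
  by case: ltngtP.
- apply/forallP=> P; apply/forallP=> Q; apply/implyP; rewrite inE => /and4P[_ _ lt _].
  apply/negP => /connectP[p pp e].
  suff : index (last Q p) (parts s) <= index Q (parts s) by rewrite -e leqNgt lt.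
  elim: p Q {lt e} pp => //= R p IH Q; rewrite inE /= => /andP[/and4P[_ _ lt _] /IH].
  by move/leq_trans; apply; apply: ltnW.
apply/eqP/setP => P; rewrite pblock_parts // !inE -in_cons -/(parts s).
apply/andP/eqP => [[Ps /forallP nout]|->]; last first.
  split; first exact: mem_head.
  by apply/forallP => Q; rewrite inE /= eqxx ltn0 !andbF.
move: (Ps); rewrite inE => /orP[/eqP//|Pls].
case/splitPr: Pls ws Ps nout => s1 s2 ws Ps nout.
have wP : word A (P :: s2) := word_catr ws.
have [rP cP] := word_connected connT wP.
have ws2 : word A s2 by case/andP: wP.
have [_ cU] := word_connected connT ws2.
move: (wP) => /= /and3P[_ P0 /and5P[PU nrP _ _ _]].
have [//||x [y [xP yU yP xy]]] := connected_cut A_sym _ cU P PU.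
  apply/eqP => e; case: (word_connected connT ws2).
  by rewrite -e (negPf nrP).
have [Q Qs yQ] := parts_cover (s1 ++ P :: s2) y.
have := nout Q; rewrite inE /= Ps Qs /=.
have -> : part_adjacent A P Q.
  apply/part_adjacentP; split; last by exists x, y; case/andP: xy.
  by apply: contraNneq yP => ->.
rewrite andbT -leqNgt => le; exfalso.
move: Qs (parts_uniq ws) le; rewrite /parts -cat_cons mem_cat => /orP[Qs1|].
  by move=> us; have := index_before us Qs1 (mem_head P s2); rewrite ltnNge => /negP.
rewrite inE => /orP[/eqP eQ|Qs2]; first by rewrite eQ (negPf yP) in yQ.
by have := rest_disjoint Qs2 yQ; rewrite yU.
Qed.

(** The recursion compares [W] with [P] exactly when [W] is separated from [P] and from all letters
    removed after [P]. *)
Lemma appendableP s W : reflect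
  (forall a P p, s = a ++ P :: p -> (forall X, X \in a -> separated A W X) ->
      separated A W P -> set_code W < set_code P)
  (appendable A s W).
Proof.
apply: (iffP idP) => [|h].
  elim: s => [|X s IH] /= aW [|Y a] P p //= [<- e] sep sP.
    by move: aW; rewrite sP => /andP[].
  apply: IH e _ sP => [|Z Za].
    by move: aW; rewrite sep ?mem_head // => /andP[].
  by apply: sep; rewrite inE Za orbT.
elim: s h => //= X s IH h; apply/implyP => sX.
rewrite (h [::] X s) //=; apply: IH => a P p e sep sP.
apply: (h (X :: a) P p) => [|Z|//]; first by rewrite e.
by rewrite inE => /orP[/eqP->//|/sep].
Qed.

Lemma common_suffix (T : eqType) (s t : seq T) : size s = size t -> s != t ->
  exists a b x y p, [/\ s = a ++ x :: p, t = b ++ y :: p & x != y].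
Proof.
elim/last_ind: s t => [|s x IH] t.
  by move/esym/size0nil => ->; rewrite eqxx.
case/lastP: t => [|t y]; rewrite !size_rcons // => -[ss].
rewrite eqseq_rcons negb_and; have [->|xy _] := eqVneq x y; last first.
  by exists s, t, x, y, [::]; rewrite !cats1.
rewrite orbF => /(IH _ ss)[a [b [x' [y' [p [-> -> ne]]]]]].
by exists a, b, x', y', (rcons p y); rewrite !rcons_cat.
Qed.

(** Let [x] and [y] be the letters of [s] and [t] at the first removal where they differ. In [s],
    [y] could be moved before [x], so the normal form makes its code smaller; by symmetry the
    reverse inequality holds too. *)
Lemma word_orientation_inj s t : word A s -> word A t ->
  [set:: parts s] = [set:: parts t] -> word_orientation s = word_orientation t -> s = t.
Proof.
move=> ws wt eP eD.
have er : rest s = rest t by rewrite -!pblock_parts // eP.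
have ss : size s = size t by apply/eqP; rewrite -eqSS -!card_parts // eP.
have eparts : parts s =i parts t by move=> P; move/setP/(_ P): eP; rewrite !inE.
have key s' t' a b x y p : word A s' -> word A t' -> parts s' =i parts t' ->
    rest s' = rest t' ->
    word_orientation s' = word_orientation t' ->
    s' = a ++ x :: p -> t' = b ++ y :: p -> x != y -> set_code y < set_code x.
  move=> {}ws {}wt {}eparts {}er {}eD es et xy.
  have ys : y \in parts s' by rewrite eparts et inE mem_cat mem_head !orbT.
  have ut := parts_uniq wt; have us := parts_uniq ws.
  have yp : y \notin p.
    by move: ut; rewrite et /= cat_uniq => /and4P[_ _ _ /andP[]].
  have ya : y \in a.
    have yx : (y == x) = false by rewrite eq_sym; apply: negPf.
    move: ys; rewrite inE es mem_cat inE (negPf yp) yx !orbF -es er.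
    case/orP => // /eqP yr; move: ut; rewrite /parts /= -yr et.
    by rewrite mem_cat mem_head orbT.
  case/splitPr: ya es => a1 a2; rewrite -catA cat_cons => es.
  have wy : word A (y :: a2 ++ x :: p) by move: ws; rewrite es => /word_catr.
  have /and3P[_ _ /and5P[_ _ _ _ /appendableP ay]] := wy.
  have uy : uniq (y :: a2 ++ x :: p).
    by move: us; rewrite es /= cat_uniq => /and4P[].
  (* An edge between [y] and [X] would point to [y] by the order in [s], but to [X] in [t], where
     [y] follows [p] directly. *)
  have sep X : X \in a2 ++ [:: x] -> separated A y X.
    move=> Xa; have Xax : X \in a2 ++ x :: p by rewrite -cat1s catA mem_cat Xa.
    have Xs : X \in parts s' by rewrite /parts es inE mem_cat inE Xax !orbT.
    have yX : y != X.
      by apply: contraTneq uy => eX; rewrite /= negb_and negbK eX Xax.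
    have Xp : X \notin p.
      have : uniq ((a2 ++ [:: x]) ++ p) by move: uy => /= /andP[_]; rewrite -catA.
      by rewrite cat_uniq => /and3P[_ /hasPn h _]; apply/negP => /h /negP.
    rewrite (separated_part_adjacent ws) //; apply/negP => adjyX.
    have : (X, y) \in word_orientation s'.
      rewrite inE; apply/and4P; split; [exact: Xs|exact: ys| |by rewrite part_adjacent_sym].
      change (index y (parts s') < index X (parts s')).
      have eL : parts s' = ((rest s' :: a1) ++ [:: y]) ++ (a2 ++ x :: p).
        by rewrite /parts [X in _ :: X]es -catA.
      rewrite eL; apply: index_before => //; first by rewrite -eL.
      by rewrite mem_cat mem_head orbT.
    rewrite eD inE /= => /and4P[Xt yt lt _].
    have : index X (parts t') < index y (parts t').
      move: Xt ut; rewrite /parts et -cat_cons mem_cat => /orP[Xb ut|].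
        by apply: index_before => //; apply: mem_head.
      by rewrite inE eq_sym (negPf yX) (negPf Xp).
    by rewrite ltnNge ltnW.
  apply: (ay a2 x p) => // [X Xa|].
    by apply: sep; rewrite mem_cat Xa.
  by apply: sep; rewrite mem_cat mem_head orbT.
apply/eqP/negPn/negP => ne.
have [a [b [x [y [p [es et xy]]]]]] := common_suffix ss ne.
have lt1 := key _ _ _ _ _ _ _ ws wt eparts er eD es et xy.
have lt2 : set_code x < set_code y.
  by apply: (key _ _ _ _ _ _ _ wt ws _ _ _ et es); rewrite 1?eq_sym // => P.
by move: (ltn_trans lt1 lt2); rewrite ltnn.
Qed.

Lemma connected_sub_closed P C Y x : conn P -> P \subset Y -> x \in P -> x \in C ->
  (forall a b, a \in C -> b \in Y -> adj a b -> b \in C) -> P \subset C.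
Proof.
move=> cP PY xP xC clC; apply/setIidPl/eqP/negPn/negP => ne.
have [|//|a [u []]] := connected_cut A_sym _ cP (P :&: C) (subsetIl _ _).
  by apply/set0Pn; exists x; rewrite inE xP.
rewrite !inE => /andP[aP aC] uP; rewrite uP /= => /negP uC au; apply: uC.
by apply: clC aC _ au; apply: (subsetP PY).
Qed.

(** * The word of an acyclic orientation, by greedy topological sorting *)

Section GreedyExtension.
Variables (k : nat) (Pi : {set {set V}}) (D : {set {set V} * {set V}}).
Hypothesis PiD : (Pi, D) \in root_oriented k.
Let R0 := pblock Pi root.

Lemma oriented_partition : partition Pi setT.
Proof. by move: PiD; rewrite !inE /= => /and4P[/and3P[]]. Qed.

Lemma oriented_disjoint P Q v : P \in Pi -> Q \in Pi -> v \in P -> v \in Q -> P = Q.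
Proof.
case/and3P: oriented_partition => _ tI _ PPi QPi vP vQ.
by rewrite -(def_pblock tI PPi vP) (def_pblock tI QPi vQ).
Qed.

Lemma oriented_cover v : exists2 P, P \in Pi & v \in P.
Proof.
case/and3P: oriented_partition => /eqP cPi _ _.
by exists (pblock Pi v); [apply: pblock_mem|rewrite mem_pblock]; rewrite cPi.
Qed.

Lemma oriented_edge P Q : (P, Q) \in D -> [/\ P \in Pi, Q \in Pi & part_adjacent A P Q].
Proof.
move: PiD; rewrite inE /= => /and4P[_ /forallP/(_ P)/forallP/(_ Q) + _ _].
by case: ifP => [/and3P[]//|_ /negPf ->].
Qed.

Lemma oriented_xor P Q : P \in Pi -> Q \in Pi -> part_adjacent A P Q ->
  ((P, Q) \in D) (+) ((Q, P) \in D).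
Proof.
move: PiD; rewrite inE /= => /and4P[_ /forallP/(_ P)/forallP/(_ Q) + _ _].
by move=> ori PPi QPi PQ; rewrite PPi QPi PQ in ori.
Qed.

Lemma oriented_root : (R0 \in Pi) && (root \in R0).
Proof.
case/and3P: oriented_partition => /eqP cPi _ _.
by rewrite /R0 mem_pblock pblock_mem cPi ?inE.
Qed.

Lemma oriented_sinkP P : P \in Pi -> reflect (exists Q, (P, Q) \in D) (P != R0).
Proof.
move=> PPi; move: PiD; rewrite inE /= => /and4P[_ _ _ /eqP/setP/(_ P)].
rewrite !inE PPi /= -/R0 => <-; rewrite negb_forall.
by apply: (iffP existsP) => -[Q]; rewrite ?negbK => PQ; exists Q; rewrite ?negbK.
Qed.

(** The number of ancestors. It grows along directed edges, which supports both the search for an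
    available part and the induction towards the sink. *)
Let depth P := #|[set Q | connect [rel a b | (a, b) \in D] Q P]|.

Lemma depth_lt P Q : (P, Q) \in D -> depth P < depth Q.
Proof.
move=> PQ; apply: proper_card; rewrite properE; apply/andP; split.
  apply/subsetP => R; rewrite !inE => /connect_trans; apply.
  exact: connect1.
apply/subsetPn; exists Q; first by rewrite inE connect0.
move: PiD; rewrite !inE /= => /and4P[_ _ /forallP/(_ P)/forallP/(_ Q) + _].
by rewrite PQ.
Qed.

(** A partial topological sort: a part is available once all its predecessors are removed, and the
    available part of largest code is removed next. The last clause yields the normal form. *)
Definition greedy p : Prop :=
  [/\ word A p, uniq p, {subset p <= Pi :\ R0},
     forall a Q b, p = a ++ Q :: b -> forall R, (R, Q) \in D -> R \in b
   & forall a P b, p = a ++ P :: b -> forall W, W \in Pi :\ R0 -> W \notin P :: b ->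
       (forall R, (R, W) \in D -> R \in b) -> set_code W < set_code P].

Lemma greedy_rest p P v : greedy p -> P \in Pi -> P \notin p -> v \in P -> v \in rest p.
Proof.
move=> [_ _ sub _ _] PPi Pp vP; have [Q] := parts_cover p v.
rewrite inE => /orP[/eqP->//|Qp] vQ.
have := sub _ Qp; rewrite inE => /andP[_ QPi].
by case/negP: Pp; rewrite (oriented_disjoint PPi QPi vP vQ).
Qed.

(** A remaining part of least depth, other than the root part, will do: a predecessor is not a sink,
    hence not the root part, and has smaller depth. *)
Lemma greedy_available p : greedy p -> size p < k -> exists W,
  [/\ W \in Pi :\ R0, W \notin p & forall R, (R, W) \in D -> R \in p].
Proof.
move=> [_ up sub _ _] ltp.
have [/andP[R0Pi _]] := oriented_root.
have cPi : #|Pi| = k.+1 by move: PiD; rewrite !inE /= => /and4P[/and3P[_ /eqP]].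
have /subsetPn[W1 W1Pi W1p] : ~~ (Pi :\ R0 \subset p).
  apply/negP => /subset_leq_card; rewrite (card_uniqP up).
  by move: cPi; rewrite (cardsD1 R0 Pi) R0Pi add1n => -[->]; rewrite leqNgt ltp.
pose X W := (W \in Pi :\ R0) && (W \notin p).
have X1 : X W1 by rewrite /X W1Pi.
case: (@arg_minnP _ W1 X depth X1) => W /andP[WPi Wp] minW.
exists W; split=> // R RW; apply/negPn/negP => Rp.
have [RPi _ _] := oriented_edge RW.
have RX : X R.
  by rewrite /X Rp andbT !inE RPi andbT; apply/(oriented_sinkP RPi); exists W.
by have := minW R RX; rewrite leqNgt depth_lt.
Qed.

Lemma greedy_step p : greedy p -> size p < k -> exists W, greedy (W :: p).
Proof.
move=> gp ltp; have [wp up sub dn gr] := gp.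
have [W1 [W1Pi W1p W1D]] := greedy_available gp ltp.
pose X W := [&& W \in Pi :\ R0, W \notin p & [forall R, ((R, W) \in D) ==> (R \in p)]].
have X1 : X W1.
  by rewrite /X W1Pi W1p; apply/forallP => R; apply/implyP; apply: W1D.
case: (@arg_maxnP _ W1 X (@set_code n) X1) => W /and3P[WPi Wp /forallP WD] maxW.
have {}WD R : (R, W) \in D -> R \in p by apply/implyP.
exists W; have := WPi; rewrite inE in_set1 => /andP[WR0 WPi'].
have [R0Pi rR0] := andP oriented_root.
have sPi P : P \in p -> P \in Pi by move/sub; rewrite inE => /andP[].
have cP P : P \in Pi -> conn P.
  by move: PiD; rewrite !inE /= => /and4P[/and3P[_ _ /forallP/(_ P)/implyP]].
have rW : root \notin W.
  by apply: contra WR0 => rW; rewrite (oriented_disjoint WPi' R0Pi rW rR0).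
have R0p : R0 \notin p by apply/negP => /sub; rewrite !inE eqxx.
have rrest : root \in rest p := greedy_rest gp R0Pi R0p rR0.
split.
- have W0 : W != set0.
    by case/and3P: oriented_partition => _ _; apply: contraNneq => <-.
  have Wr : W \subset rest p.
    by apply/subsetP => v; apply: greedy_rest.
  (* If [W] is separated from [P] and from the letters removed after it, all predecessors of [W] lie
     in [b]; so [W] was available when [P] was chosen. *)
  have aW : appendable A p W.
    apply/appendableP => a P b e sep sP.
    apply: (gr a P b e) => //.
      by apply: contra Wp; rewrite e mem_cat => ->; rewrite orbT.
    move=> R RW; have := WD _ RW; rewrite e mem_cat inE.
    have [RPi _ RWadj] := oriented_edge RW.
    have nsep : ~~ separated A W R.
      case/part_adjacentP: RWadj => ne [x [y [xR yW xy]]].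
      apply/negP => /separatedP/(_ _ _ yW xR).
      rewrite /adjacent /= A_sym xy andbT negbK => /eqP yx.
      by case/eqP: ne; apply: (oriented_disjoint RPi WPi' xR); rewrite -yx.
    by case/or3P => // [/sep|/eqP eR]; [|move: sP; rewrite -eR]; rewrite (negPf nsep).
  rewrite /= wp W0 Wr rW cP // aW andbT /=.
  have [|C [CY rC cC clC]] := @component _ _ A_sym (rest p :\: W) root.
    by rewrite inE rrest rW.
  suff -> : rest p :\: W = C by [].
  apply/eqP; rewrite eqEsubset CY andbT.
  have PY P : P \in Pi -> P \notin p -> P != W -> P \subset rest p :\: W.
    move=> PPi Pp PW; apply/subsetP => v vP; rewrite inE (greedy_rest gp PPi) // andbT.
    by apply: contra PW => vW; rewrite (oriented_disjoint PPi WPi' vP vW).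
  (* Every remaining part joins the component of the root by following outgoing edges, along which
     depth grows up to the bound [#|{set V}|]. The parts met were not removed before, since their
     predecessors go first. *)
  have main m : forall P, #|{set V}| - depth P <= m ->
      P \in Pi -> P \notin p -> P != W -> P \subset C.
    elim: m => [|m IH] P lem PPi Pp PW; have sub1 := PY _ PPi Pp PW.
      have [->|/(oriented_sinkP PPi)[Q PQ]] := eqVneq P R0.
        apply: (connected_sub_closed (cP _ R0Pi) _ rR0 rC clC).
        by apply: PY => //; rewrite eq_sym.
      have := depth_lt PQ; move: lem; rewrite leqn0 subn_eq0 => le1 lt1.
      by have := leq_ltn_trans le1 lt1; rewrite ltnNge /depth max_card.
    have [->|/(oriented_sinkP PPi)[Q PQ]] := eqVneq P R0.
      apply: (connected_sub_closed (cP _ R0Pi) _ rR0 rC clC).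
      by apply: PY => //; rewrite eq_sym.
    have [_ QPi adjPQ] := oriented_edge PQ.
    have QC : Q \subset C.
      apply: IH => //.
      - have lt := depth_lt PQ; have leQ : depth Q <= #|{set V}| by apply: max_card.
        rewrite -ltnS; apply: leq_trans lem.
        by apply: ltn_sub2l => //; apply: leq_trans lt leQ.
      - apply: contra Pp => Qp.
        have [a [b e]] : exists a b, p = a ++ Q :: b.
          by case/splitPr: Qp => a b; exists a, b.
        by rewrite e mem_cat inE (dn a Q b e _ PQ) !orbT.
      by apply: contraNneq Pp => eQ; apply: WD; rewrite -eQ.
    case/part_adjacentP: adjPQ => ne [x [y [xP yQ xy]]].
    have xC : x \in C.
      apply: clC (subsetP QC _ yQ) (subsetP sub1 _ xP) _.
      rewrite /adjacent /= A_sym xy andbT; apply: contraNneq ne => yx.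
      by apply/eqP/(oriented_disjoint PPi QPi xP); rewrite -yx.
    exact: (connected_sub_closed (cP _ PPi) sub1 xP xC clC).
  apply/subsetP => v; rewrite inE => /andP[vW vr].
  have [P PPi vP] := oriented_cover v.
  apply: (subsetP (main _ _ (leqnn _) PPi _ _)) => //.
    by apply/negP => /rest_disjoint/(_ vP); rewrite vr.
  by apply: contraNneq vW => <-.
- by rewrite /= Wp up.
- by move=> P; rewrite in_cons => /orP[/eqP ->//|/sub].
- move=> [|Z a] Q b /= [eW ep] R; first by rewrite -eW -ep; apply: WD.
  exact: dn ep R.
move=> [|Z a] P b /= [eW ep] W' W'Pi; last exact: gr ep W' W'Pi.
rewrite -eW -ep inE negb_or => /andP[W'W W'p] W'D.
rewrite ltn_neqAle; apply/andP; split.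
  by apply: contra W'W => /eqP/set_code_inj ->.
apply: maxW; rewrite /X W'Pi W'p; apply/forallP => R; apply/implyP.
exact: W'D.
Qed.

Lemma greedy_exists : exists2 s, greedy s & size s = k.
Proof.
suff H m : m <= k -> exists2 s, greedy s & size s = m by apply: H.
elim: m => [|m IH] le; first by exists [::] => //; split=> // -[].
have [s gs sm] := IH (ltnW le).
by have [|W gW] := greedy_step gs; [rewrite sm|exists (W :: s); rewrite //= sm].
Qed.

(** After [k] removals only the root part is left. Removal respects [D], so [D] is contained in the
    orientation of the word; equality follows because each edge has exactly one direction. *)
Lemma greedy_orientation s : greedy s -> size s = k ->
  [set:: parts s] = Pi /\ word_orientation s = D.
Proof.
move=> gs sk; have [ws us sub dn _] := gs.
have [R0Pi rR0] := andP oriented_root.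
have R0s : R0 \notin s by apply/negP => /sub; rewrite !inE eqxx.
have cPi : #|Pi| = k.+1 by move: PiD; rewrite !inE /= => /and4P[/and3P[_ /eqP]].
have sE : Pi :\ R0 \subset s.
  have : [set:: s] == Pi :\ R0.
    rewrite eqEcard; apply/andP; split.
      by apply/subsetP => P; rewrite inE; apply: sub.
    move: cPi; rewrite (cardsD1 R0 Pi) R0Pi add1n => -[->].
    by rewrite cardsE (card_uniqP us) sk.
  by move/eqP => <-; apply/subsetP => P; rewrite inE.
have er : rest s = R0.
  apply/setP => v; apply/idP/idP => [vr|vR]; last exact: greedy_rest gs R0Pi R0s vR.
  have [P PPi vP] := oriented_cover v; have [<-//|ne] := eqVneq P R0.
  have /(subsetP sE) Ps : P \in Pi :\ R0 by rewrite !inE ne.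
  by have := rest_disjoint Ps vP; rewrite vr.
have ePi : [set:: parts s] = Pi.
  apply/setP => P; rewrite inE inE er; have [->|ne] := eqVneq P R0; first by rewrite R0Pi.
  apply/idP/idP => [/sub|PPi]; first by rewrite !inE => /andP[].
  by apply: (subsetP sE); rewrite !inE ne.
have memP P : (P \in parts s) = (P \in Pi) by rewrite -ePi [RHS]inE.
have inc P Q : (P, Q) \in D -> (P, Q) \in word_orientation s.
  move=> PQ; have [PPi QPi adjPQ] := oriented_edge PQ.
  rewrite inE; apply/and4P; split; rewrite ?memP //.
  change (index Q (parts s) < index P (parts s)).
  have PR0 : P != R0 by apply/(oriented_sinkP PPi); exists Q.
  have up := parts_uniq ws.
  have Ps : P \in s by apply: (subsetP sE); rewrite !inE PR0.
  have [eQ|QR0] := eqVneq Q R0.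
    rewrite /parts -cat1s in up *.
    by apply: index_before => //; rewrite eQ er mem_head.
  have Qs : Q \in s by apply: (subsetP sE); rewrite !inE QR0.
  have [a [b e]] : exists a b, s = a ++ Q :: b.
    by case/splitPr: Qs => a b; exists a, b.
  have eL : parts s = (rest s :: a ++ [:: Q]) ++ b by rewrite /parts [X in _ :: X]e /= -catA.
  rewrite eL in up *; apply: index_before => //; last exact: dn e _ PQ.
  by rewrite inE mem_cat mem_head !orbT.
split=> //; apply/setP => -[P Q]; apply/idP/idP => [PQ|]; last exact: inc.
move: (PQ); rewrite inE => /and4P[Ps Qs lt adjPQ]; rewrite !memP in Ps Qs.
have := oriented_xor Ps Qs adjPQ.
case: ((P, Q) \in D) => //= QP; have := inc _ _ QP; rewrite inE => /and4P[_ _ lt' _].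
have {}lt : index Q (parts s) < index P (parts s) by [].
have {}lt' : index P (parts s) < index Q (parts s) by [].
by have := ltn_trans lt lt'; rewrite ltnn.
Qed.

End GreedyExtension.

Definition words k : {set k.-tuple {set V}} := [set t : k.-tuple {set V} | word A t].

Lemma card_words k : #|words k| = \sum_(Pi in connected_partitions A k.+1) alpha A Pi.
Proof.
rewrite -card_root_oriented.
pose f (t : k.-tuple {set V}) := ([set:: parts t], word_orientation t).
rewrite -(@card_in_imset _ _ f) => [|s t].
  apply: eq_card => -[Pi D]; apply/imsetP/idP => [[t]|PiD].
    rewrite inE => wt ->; have := word_root_oriented wt.
    by rewrite size_tuple.
  have [s gs sk] := greedy_exists PiD.
  have [eP eD] := greedy_orientation PiD gs sk.
  exists (Tuple (introT eqP sk)); first by rewrite inE; case: gs.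
  by rewrite /f /= eP eD.
rewrite !inE => ws wt [eP eD]; apply: val_inj.
exact: word_orientation_inj eP eD.
Qed.

End WordParts.

(** * The frame of words, and reduced monomials *)

Section WordFrame.
Local Open Scope ring_scope.
Variables (n : nat) (A : 'M[nat]_n.+1).
Hypothesis A_sym : forall i j, A i j = A j i.
Local Notation V := 'I_n.+1.
Local Notation root := (@ord_max n).
Local Notation adj := (adjacent A).
Hypothesis connT : connected_on A setT.

Definition word_rank k : nat := #|words A k|.

Definition word_at k (i : 'I_(word_rank k)) : k.-tuple {set V} := enum_val i.

Lemma word_atP k (i : 'I_(word_rank k)) : word A (word_at i).
Proof. by have := enum_valP i; rewrite inE. Qed.

Lemma word_at_inj k : injective (@word_at k).
Proof. exact: enum_val_inj. Qed.

Lemma word_at_onto k (t : k.-tuple {set V}) : word A t -> exists i, word_at i = t.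
Proof.
move=> wt; have tk : t \in words A k by rewrite inE.
by exists (enum_rank_in tk t); rewrite /word_at enum_rankK_in.
Qed.

Lemma behead_word k (j : 'I_(word_rank k.+1)) :
  ([tuple of behead (word_at j)] : k.-tuple _) \in words A k.
Proof.
rewrite inE /=; case: (word_at j) (word_atP j) => -[|W s] //= _.
by case/andP.
Qed.

Definition word_par k (j : 'I_(word_rank k.+1)) : 'I_(word_rank k) :=
  enum_rank_in (behead_word j) [tuple of behead (word_at j)].

Definition last_letter k (j : 'I_(word_rank k.+1)) : {set V} := thead (word_at j).

Lemma word_at_cons k (j : 'I_(word_rank k.+1)) :
  word_at j = last_letter j :: word_at (word_par j) :> seq {set V}.
Proof.
rewrite /word_par /last_letter [word_at (enum_rank_in _ _)]enum_rankK_in ?behead_word //.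
by case/tupleP: (word_at j) => W t; rewrite theadE.
Qed.

Lemma word_child k (i : 'I_(word_rank k)) W : word A (W :: word_at i) ->
  exists j, word_par j = i /\ last_letter j = W.
Proof.
move=> wW; have [j ej] := @word_at_onto k.+1 [tuple of W :: word_at i] wW.
have := word_at_cons j; rewrite ej /= => -[eW ei].
by exists j; split; [apply/word_at_inj/val_inj|].
Qed.

Definition letter_code k (j : 'I_(word_rank k.+1)) : nat := set_code (last_letter j).

Lemma word_rank0 (i i' : 'I_(word_rank 0)) : i = i'.
Proof. by apply: word_at_inj; rewrite (tuple0 (word_at i)) (tuple0 (word_at i')). Qed.

Lemma word_rank0_ex : exists i : 'I_(word_rank 0), True.
Proof. by have [i _] := @word_at_onto 0 [tuple] isT; exists i. Qed.

(** * Standard monomials modulo the two ideals *)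

Section Degree.
Variables (N : nat) (src : 'I_N -> V) (b : 'I_N -> V -> nat).
Hypothesis b_adj : forall z u, u != src z -> (0 < b z u)%N -> adj (src z) u.
Variable wt : 'X_{1..N} -> nat.
Hypothesis wtD : forall m m', wt (m + m')%MM = (wt m + wt m')%N.

Definition frame_degree k (i : 'I_(word_rank k)) : 'X_{1..N} :=
  word_degree src b (word_at i).

Lemma frame_degree0 (i : 'I_(word_rank 0)) : frame_degree i = 0%MM.
Proof.
by apply/mnmP => z; rewrite word_degreeE mnm0E (tuple0 (word_at i)).
Qed.

Lemma frame_degree_par k (j : 'I_(word_rank k.+1)) :
  (frame_degree (word_par j) <= frame_degree j)%MM.
Proof.
apply/mnm_lepP => z; rewrite !word_degreeE word_at_cons /=.
exact: leq_addr.
Qed.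

Lemma word_frame :
  schreyer_frame word_par (@code_bound n) letter_code frame_degree wt.
Proof.
split=> //.
- by move=> k j; apply: set_code_bound.
- move=> k j j' ep /set_code_inj el; apply/word_at_inj/val_inj.
  by rewrite /= !word_at_cons ep el.
- exact: frame_degree_par.
move=> k j M Ej; have wj := word_atP j; rewrite word_at_cons in wj.
rewrite /frame_degree word_at_cons in Ej; split=> [[l [pl El]]|[j' [pj' Ej' lt]]].
  have wl := word_atP l; rewrite /frame_degree word_at_cons pl word_at_cons in El.
  rewrite word_at_cons pl word_at_cons in wl.
  have [X [wX dX lt]] := word_colon_left A_sym b_adj connT wl El.
  have [j' [pj' lj']] := word_child wX; exists j'.
  by rewrite /frame_degree word_at_cons pj' lj' /letter_code lj'.
have wj' := word_atP j'; rewrite word_at_cons pj' in wj'.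
rewrite /frame_degree word_at_cons pj' in Ej'.
have [W' [wW' dW']] := word_colon_right A_sym b_adj connT wj Ej wj' Ej' lt.
rewrite -word_at_cons in wW' dW'.
have [l [pl ll]] := word_child wW'.
by exists l; rewrite /frame_degree word_at_cons pl ll.
Qed.

Lemma standard0P M (i : 'I_(word_rank 0)) S : standard word_par frame_degree M i ->
  S != set0 -> root \notin S -> ~~ (cut_degree src b S (~: S) <= M)%MM.
Proof.
move=> st S0 rS; apply/negP => SM.
have [W [wW dW]] := cut_divides A_sym b_adj connT S0 rS SM.
have ei : word_at i = [::] :> seq _ by rewrite (tuple0 (word_at i)).
rewrite -ei in wW; have [j [pj lj]] := word_child wW.
move/forallP/(_ j)/implyP: st; rewrite pj eqxx => /(_ isT)/negP; apply.
by rewrite /frame_degree word_at_cons pj lj ei.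
Qed.

Variable K : fieldType.
Local Notation S := {mpoly K[N]}.

Definition cut_ideal : S -> Prop := ideal_gen (fun p => exists X : {set V},
  [/\ X != set0, root \notin X & p = 'X_[cut_degree src b X (~: X)]]).

(** [f] is a firing vector. For [src = id] and [b = A] the right-hand side is its product with the
    Laplacian; differences of [f] make sense for edge variables too. *)
Definition lattice_equiv (u v : 'X_{1..N}) : Prop := exists f : V -> int,
  forall z, (u z)%:Z - (v z)%:Z = \sum_w (b z w)%:Z * (f (src z) - f w).

Definition lattice_ideal : S -> Prop := ideal_gen (fun p =>
  exists u v, lattice_equiv u v /\ p = 'X_[u] - 'X_[v]).

Definition augmented (I : S -> Prop) : 'rV[S]_(word_rank 0) -> Prop :=
  fun v => I ((v *m (const_mx 1 : 'cV_(word_rank 0))) 0 0).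

Lemma augmentedE I v (i : 'I_(word_rank 0)) : augmented I v = I (v 0 i).
Proof.
rewrite /augmented mxE (bigD1 i) //= mxE mulr1 big1 ?addr0 // => j.
by rewrite (word_rank0 j i) eqxx.
Qed.

Lemma augmented_submodule (J : S -> Prop) : submodule (augmented (ideal_gen J)).
Proof.
rewrite /augmented; split.
- by rewrite mul0mx mxE; apply: ideal_gen0.
- move=> u v Iu Iv; rewrite mulmxBl mxE [(- _ : 'M_(_, _)) _ _]mxE.
  exact: ideal_genB.
by move=> a u Iu; rewrite -scalemxAl mxE; apply: ideal_genM.
Qed.

Lemma no_standard_of_ideal (I : S -> Prop) :
  (forall p, I p -> (forall m, m \in msupp p -> forall X : {set V}, X != set0 ->
      root \notin X -> ~~ (cut_degree src b X (~: X) <= m)%MM) -> p = 0) ->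
  no_standard word_par frame_degree (augmented I).
Proof.
move=> h z Iz st; apply/matrixP => i0 i; rewrite (ord1 i0) [RHS]mxE.
rewrite (augmentedE I z i) in Iz; apply: h Iz _ => m mz X X0 rX.
by have := st _ _ mz; rewrite frame_degree0 addm0 => /standard0P; apply.
Qed.

Lemma cut_ideal_no_standard : no_standard word_par frame_degree (augmented cut_ideal).
Proof.
apply: no_standard_of_ideal => p [s sS ->] st; apply/msuppnil0.
case E : (msupp _) => [|m ms] //.
have : m \in msupp (\sum_(c <- s) c.1 * c.2) by rewrite E mem_head.
move=> mp; have := st m mp; move: mp => /msupp_sum_le /flattenP[/= t /mapP[c]].
rewrite mem_filter => /andP[_ cs] ->; have [X [X0 rX ->]] := sS c cs.
rewrite (perm_mem (msuppMX _ _)) => /mapP[m' _ ->] /(_ X X0 rX).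
by rewrite lem_addr.
Qed.

Section CoefSum.
Variable f : 'X_{1..N} -> K.

(** The linear functional with value [f m] on the monomial [m]; it is applied to the indicator of a
    lattice class. *)
Definition coef_sum (p : S) : K := \sum_(m <- msupp p) p@_m * f m.

Lemma coef_sumE s p : uniq s -> {subset msupp p <= s} ->
  coef_sum p = \sum_(m <- s) p@_m * f m.
Proof.
move=> us sub; rewrite [RHS](bigID (mem (msupp p))) /= [X in _ + X]big1 ?addr0.
  rewrite -big_filter /coef_sum; apply: perm_big; apply: uniq_perm.
  - exact: msupp_uniq.
  - exact: filter_uniq.
  by move=> m; rewrite mem_filter; case: (boolP (m \in _)) => // /sub ->.
by move=> m /memN_msupp_eq0 ->; rewrite mul0r.
Qed.

Lemma coef_sumD p q : coef_sum (p + q) = coef_sum p + coef_sum q.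
Proof.
pose s := undup (msupp p ++ msupp q ++ msupp (p + q)).
rewrite !(@coef_sumE s) ?undup_uniq //; last first.
- by move=> m mp; rewrite mem_undup !mem_cat mp ?orbT.
- by move=> m mp; rewrite mem_undup !mem_cat mp ?orbT.
- by move=> m mp; rewrite mem_undup !mem_cat mp ?orbT.
by rewrite -big_split; apply: eq_bigr => m _; rewrite mcoeffD mulrDl.
Qed.

Lemma coef_sumX c m : coef_sum (c *: 'X_[m]) = c * f m.
Proof.
rewrite (@coef_sumE [:: m]) // ?big_seq1 ?mcoeffZ ?mcoeffX ?eqxx ?mulr1 //.
by move=> m' /msuppZ_le; rewrite msuppX.
Qed.

Lemma coef_sum0 : coef_sum 0 = 0.
Proof. by rewrite /coef_sum msupp0 big_nil. Qed.

End CoefSum.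

Lemma lattice_equiv_refl u : lattice_equiv u u.
Proof.
exists (fun=> 0) => z; rewrite subrr big1 // => w _.
by rewrite subrr mulr0.
Qed.

Lemma lattice_equiv_sym u v : lattice_equiv u v -> lattice_equiv v u.
Proof.
move=> [f fP]; exists (fun w => - f w) => z; rewrite -opprB fP -sumrN.
by apply: eq_bigr => w _; rewrite -mulrN opprB opprK addrC.
Qed.

Lemma lattice_equiv_trans u v w : lattice_equiv u v -> lattice_equiv v w -> lattice_equiv u w.
Proof.
move=> [f fP] [g gP]; exists (fun w => f w + g w) => z.
rewrite -(subrK (v z)%:Z (u z)%:Z) -addrA fP gP -big_split; apply: eq_bigr => x _ /=.
by rewrite -mulrDr; congr (_ * _); rewrite opprD addrACA.
Qed.

Lemma lattice_equivD m u v : lattice_equiv u v -> lattice_equiv (m + u) (m + v).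
Proof.
by move=> [f fP]; exists f => z; rewrite -fP !mnmDE !PoszD opprD addrACA subrr add0r.
Qed.

(* Dhar: a maximum of the firing vector away from the root would make the set  *)
(* where it is attained divide [u].                                            *)
Lemma superstable_max (u v : 'X_{1..N}) (f : V -> int) :
  (forall z, (u z)%:Z - (v z)%:Z = \sum_w (b z w)%:Z * (f (src z) - f w)) ->
  (forall X : {set V}, X != set0 -> root \notin X ->
     ~~ (cut_degree src b X (~: X) <= u)%MM) ->
  forall w, f w <= f root.
Proof.
move=> fP st w0; have [x _ xmax] := @arg_maxP _ _ _ root xpredT f isT.
apply: le_trans (xmax w0 isT) _; rewrite leNgt; apply/negP => lt.
pose X := [set w | f w == f x].
have := st X; rewrite inE lt_eqF // => /(_ _ isT)/negP; apply.
  by apply/set0Pn; exists x; rewrite inE.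
apply/mnm_lepP => z; rewrite cut_degreeE inE; case: eqP => // fz.
rewrite -lez_nat; have -> : (u z)%:Z = (v z)%:Z + \sum_w (b z w)%:Z * (f (src z) - f w).
  by rewrite -fP addrC subrK.
rewrite -[X in X <= _]add0r; apply: lerD => //.
rewrite (big_morph Posz PoszD (erefl 0%:Z)) big_mkcond /=; apply: ler_sum => w _; rewrite !inE fz.
have : f w <= f x by apply: xmax.
rewrite [f w <= f x]le_eqVlt; case: eqP => [->|_ /= ltw].
  by rewrite subrr mulr0.
rewrite -[X in X <= _]mulr1; apply: ler_wpM2l => //.
by rewrite -gtz0_ge1 subr_gt0.
Qed.

(** [superstable_max] applies to [f] and, with [u] and [v] exchanged, to its negative; hence [f] is
    constant. *)
Lemma superstable_unique u v : lattice_equiv u v ->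
  (forall X : {set V}, X != set0 -> root \notin X ->
     ~~ (cut_degree src b X (~: X) <= u)%MM) ->
  (forall X : {set V}, X != set0 -> root \notin X ->
     ~~ (cut_degree src b X (~: X) <= v)%MM) -> u = v.
Proof.
move=> [f fP] su sv; have max1 := superstable_max fP su.
have fP' z : (v z)%:Z - (u z)%:Z = \sum_w (b z w)%:Z * (- f (src z) - - f w).
  by rewrite -opprB fP -sumrN; apply: eq_bigr => w _; rewrite -mulrN opprB opprK addrC.
have max2 := superstable_max (f := fun w => - f w) fP' sv.
have fc w : f w = f root.
  by apply/eqP; rewrite eq_le max1 /= -lerN2 max2.
apply/mnmP => z; have := fP z; rewrite big1 => [/eqP|w _].
  by rewrite subr_eq0 eqz_nat => /eqP.
by rewrite !fc subrr mulr0.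
Qed.

(** Summing coefficients over the lattice class of [m0] gives 0 on the ideal. By
    [superstable_unique] the monomials of [p] lie in distinct classes, so this sum is the
    coefficient of [m0]. *)
Lemma lattice_ideal_no_standard :
  no_standard word_par frame_degree (augmented lattice_ideal).
Proof.
apply: no_standard_of_ideal => p Ip st; apply/msuppnil0.
case E : (msupp p) => [|m0 ms] //; have {E} m0p : m0 \in msupp p by rewrite E mem_head.
pose f m : K := if excluded_middle_informative (lattice_equiv m m0) then 1 else 0.
have fe u v : lattice_equiv u v -> f u = f v.
  rewrite /f => uv; case: excluded_middle_informative => hu;
    case: excluded_middle_informative => hv //.
    by case: hv; apply: lattice_equiv_trans (lattice_equiv_sym uv) hu.
  by case: hu; apply: lattice_equiv_trans uv hv.
have : coef_sum f p = 0.
  case: Ip => s sS ->; rewrite big_seq.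
  apply: (big_ind (fun q => coef_sum f q = 0)) => [|q1 q2 e1 e2|c /sS].
  - exact: coef_sum0.
  - by rewrite coef_sumD e1 e2 addr0.
  move=> [u [v [uv ->]]]; rewrite [c.1]mpolyE mulr_suml.
  apply: (big_ind (fun q => coef_sum f q = 0)) => [|q1 q2 e1 e2|m _].
  - exact: coef_sum0.
  - by rewrite coef_sumD e1 e2 addr0.
  rewrite -scalerAl mulrBr -!mpolyXD scalerBr -scaleNr coef_sumD !coef_sumX.
  by rewrite (fe _ _ (lattice_equivD m uv)) mulNr subrr.
rewrite /coef_sum (bigD1_seq m0) ?msupp_uniq //= big1_seq => [|m /andP[mm0 mp]].
  rewrite addr0 /f; case: excluded_middle_informative => [h|[]] /=; last first.
    exact: lattice_equiv_refl.
  by rewrite mulr1 => e0; move: m0p; rewrite mcoeff_msupp e0 eqxx.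
rewrite /f; case: excluded_middle_informative => [eqv|h] /=; last by rewrite mulr0.
by case/eqP: mm0; apply: superstable_unique eqv (st _ mp) (st _ m0p).
Qed.

End Degree.
End WordFrame.

(** * The edge ring *)

Section EdgeRing.
Variables (n : nat) (A : 'M[nat]_n.+1).
Hypothesis A_sym : forall i j, A i j = A j i.
Local Notation V := 'I_n.+1.
Local Notation root := (@ord_max n).
Local Notation adj := (adjacent A).
Hypothesis connT : connected_on A setT.

(** [y] is a neighbour of [C]. Scaling by [L], which exceeds every row sum, turns strict
    inequalities on [C] into gaps that absorb the increase by 1 outside. At [y], one neighbour in
    [C] is lower by at least [L] and no neighbour is higher by more than 1. *)
Lemma superharmonic_extend (C : {set V}) (q : V -> nat) (T : nat) :
  C != setT -> root \in C -> (forall u, u \in C -> q u < T) ->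
  (forall u, u \notin C -> q u = T) ->
  (forall v, v \in C -> v != root -> \sum_u A v u * q u < \sum_u A v u * q v) ->
  exists y q' T', [/\ y \notin C, forall u, u \in y |: C -> q' u < T',
     forall u, u \notin y |: C -> q' u = T' &
     forall v, v \in y |: C -> v != root ->
        \sum_u A v u * q' u < \sum_u A v u * q' v].
Proof.
move=> CnT rC ltT eqT sh.
have [|//|x [y [xC _ yC xy]]] := connected_cut A_sym _ connT C (subsetT _).
  by apply/set0Pn; exists root.
pose L := (\sum_v \sum_u A v u).+1.
have ltL v : \sum_u A v u < L by rewrite /L ltnS [X in _ <= X](bigD1 v) //= leq_addr.
pose q' u := if u \in C then L * q u else if u == y then L * T else (L * T).+1.
exists y, q', (L * T).+1; split=> // [u|u|v].
- rewrite in_setU1 /q' ltnS; case: (boolP (u \in C)) => [uC _|_]; first by rewrite leq_mul2l (ltnW (ltT u uC)) orbT.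
  by rewrite orbF => ->.
- by rewrite in_setU1 negb_or /q' => /andP[/negPf -> /negPf ->].
have q'le u : q' u <= (L * T).+1.
  rewrite /q'; case: ifP => uC; last by case: ifP.
  by rewrite leqW // leq_mul2l (ltnW (ltT u uC)) orbT.
rewrite in_setU1; case: (boolP (v \in C)) => [vC _ vr|vC].
  have -> : \sum_u A v u * q' v = L * \sum_u A v u * q v.
    by rewrite big_distrr; apply: eq_bigr => u _; rewrite /q' vC mulnCA.
  apply: (@leq_trans (L * (\sum_u A v u * q u).+1)); last by rewrite leq_mul2l sh ?orbT.
  rewrite mulnS addnC; apply: (@leq_ltn_trans (L * (\sum_u A v u * q u) + \sum_u A v u)).
    rewrite big_distrr -big_split; apply: leq_sum => u _ /=.
    rewrite mulnCA -[X in _ <= _ + X]muln1 -mulnDr leq_mul2l; apply/orP; right.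
    rewrite /q'; case: ifP => uC; first exact: leq_addr.
    by rewrite eqT ?uC // addn1; case: ifP.
  by rewrite ltn_add2l.
rewrite orbF => /eqP -> _.
have Ayx : 0 < A y x by case/andP: xy => _; rewrite A_sym.
have le : \sum_u A y u * q' u + A y x * L <= \sum_u A y u * (L * T).+1.
  rewrite (bigD1 x) //= [X in _ <= X](bigD1 x) //= addnAC; apply: leq_add.
    rewrite -mulnDr leq_mul2l /q' xC -{2}[L]muln1 -mulnDr.
    by rewrite leqW ?orbT // leq_mul2l addn1 (ltT x xC) orbT.
  by apply: leq_sum => u _; rewrite leq_mul2l q'le orbT.
have e : \sum_u A y u * (L * T).+1 = \sum_u A y u * q' y + \sum_u A y u.
  rewrite -big_split; apply: eq_bigr => u _ /=.
  by rewrite /q' (negPf yC) eqxx mulnS addnC.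
rewrite -(ltn_add2r (A y x * L)); apply: (leq_ltn_trans le); rewrite e ltn_add2l.
by apply: leq_trans (ltL y) _; apply: leq_pmull.
Qed.

Lemma superharmonic_exists : exists q : V -> nat,
  forall v, v != root -> \sum_u A v u * q u < \sum_u A v u * q v.
Proof.
suff H m : forall (C : {set V}) (q : V -> nat) (T : nat), #|~: C| <= m -> root \in C ->
    (forall u, u \in C -> q u < T) -> (forall u, u \notin C -> q u = T) ->
    (forall v, v \in C -> v != root -> \sum_u A v u * q u < \sum_u A v u * q v) ->
    exists q' : V -> nat,
      forall v, v != root -> \sum_u A v u * q' u < \sum_u A v u * q' v.
  (* For [C = [set root]] the inequality is void. *)
  apply: (H #|~: [set root]| [set root] (fun u => (u != root) : nat) 1) => //.
  - by rewrite inE.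
  - by move=> u; rewrite inE => /eqP ->; rewrite eqxx.
  - by move=> u; rewrite inE => ->.
  by move=> v; rewrite inE => ->.
elim: m => [|m IH] C q T le rC ltT eqT sh; have [eC|nC] := eqVneq C setT.
- by exists q => v; apply: sh; rewrite eC.
- by move: le nC; rewrite leqn0 cards_eq0 => /eqP e; rewrite -(setCK C) e setC0 eqxx.
- by exists q => v; apply: sh; rewrite eC.
have [y [q' [T' [yC ltT' eqT' sh']]]] := superharmonic_extend nC rC ltT eqT sh.
apply: (IH (y |: C) q' T') => //; last by rewrite in_setU1 rC orbT.
rewrite -ltnS; apply: leq_trans le; apply: proper_card.
rewrite properE setCS subsetUr; apply/subsetPn; exists y; first by rewrite inE.
by rewrite !inE eqxx.
Qed.

Lemma A_adj v u : u != v -> 0 < A v u -> adj v u.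
Proof. by move=> uv Avu; rewrite /adjacent /= eq_sym uv. Qed.

Local Notation NE := #|{: V * V}|.

Definition edge_src (z : 'I_NE) : V := (enum_val z).1.
Lemma edge_srcE p : edge_src (enum_rank p) = p.1.
Proof. by rewrite /edge_src enum_rankK. Qed.

(** Each edge counts once, whatever its weight, which enters only on specialization; pairs that are
    not adjacent, loops among them, count 0. *)
Definition edge_in (z : 'I_NE) (u : V) : nat :=
  (u == (enum_val z).2) && adj (edge_src z) u.

Lemma edge_in_adj z u : u != edge_src z -> 0 < edge_in z u -> adj (edge_src z) u.
Proof. by rewrite /edge_in; case: andP => // -[]. Qed.

Lemma edge_in_sum v u (X : {set V}) :
  \sum_(w in X) edge_in (enum_rank (v, u)) w = (u \in X) && adj v u.
Proof.
rewrite /edge_in /edge_src enum_rankK /=; case: (boolP (u \in X)) => uX /=.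
  rewrite (bigD1 u) //= eqxx /= big1 ?addn0 // => w /andP[_ /negPf ->] //.
by rewrite big1 // => w wX; case: eqP => // e; rewrite -e wX in uX.
Qed.

(** The action on exponents of substituting [x_v ^ A v u] for the variable of [(v, u)]. *)
Definition specialize (m : 'X_{1..NE}) : 'X_{1..n.+1} :=
  (\sum_(z < NE) (U_(edge_src z) *+ A (edge_src z) (enum_val z).2) *+ m z)%MM.

Lemma specializeE m v : specialize m v = \sum_u A v u * m (enum_rank (v, u)).
Proof.
rewrite /specialize mnm_sumE.
under eq_bigr => z _ do rewrite !mulmnE mnm1E -[in m z](enum_valK z) /edge_src.
rewrite -(big_enum_val (fun p : V * V => (p.1 == v) * A p.1 p.2 * m (enum_rank p))).
transitivity (\sum_a \sum_c (a == v) * A a c * m (enum_rank (a, c))).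
  by rewrite pair_bigA; apply: eq_big => -[a c].
rewrite (bigD1 v) //= [X in _ + X]big1 ?addn0 => [|a /negPf av].
  by apply: eq_bigr => u _; rewrite eqxx mul1n.
by rewrite big1 // => c _; rewrite av.
Qed.

Lemma specializeD m m' : specialize (m + m') = (specialize m + specialize m')%MM.
Proof.
apply/mnmP => v; rewrite mnmDE !specializeE -big_split.
by apply: eq_bigr => u _; rewrite mnmDE mulnDr.
Qed.

Lemma specialize_cut_sum v (X : {set V}) : v \notin X ->
  \sum_u A v u * ((u \in X) && adj v u) = \sum_(u in X) A v u.
Proof.
move=> vX; rewrite [RHS]big_mkcond; apply: eq_bigr => u _.
case: ifP => uX; last by rewrite muln0.
have uv : u != v by apply: contraNneq vX => <-.
have [->|Avu] := posnP (A v u); first by rewrite mul0n.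
by rewrite A_adj ?muln1.
Qed.

Lemma specialize_cut (W X : {set V}) : [disjoint W & X] ->
  specialize (cut_degree edge_src edge_in W X) = cut_degree id A W X.
Proof.
move=> WX; apply/mnmP => v; rewrite specializeE cut_degreeE.
under eq_bigr => u _.
  rewrite cut_degreeE edge_srcE edge_in_sum; over.
case: ifP => vW; last by rewrite big1 // => u _; rewrite muln0.
by rewrite specialize_cut_sum // (disjointFr WX).
Qed.

Lemma specialize_word s : word A s ->
  specialize (word_degree edge_src edge_in s) = word_degree id A s.
Proof.
move=> ws; apply/mnmP => v; rewrite specializeE word_degreeE.
under eq_bigr do rewrite word_degreeE.
elim: s ws => [|W s IH] /= ws; first by rewrite big1 // => u _; rewrite muln0.
have {}ws : word A s by case/andP: ws.
under eq_bigr => u _.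
  rewrite edge_srcE edge_in_sum mulnDr; over.
rewrite big_split IH //; congr (_ + _).
case: ifP => vW; last by rewrite big1 // => u _; rewrite muln0.
by rewrite specialize_cut_sum // !inE vW.
Qed.

(* The grading by undirected edges, in which both kinds of generators are     *)
(* homogeneous.                                                                *)
Definition edge_grade (m : 'X_{1..NE}) : {ffun V * V -> nat} :=
  [ffun p => m (enum_rank p) + m (enum_rank (p.2, p.1))].

Lemma edge_gradeD m m' m'' : edge_grade m' = edge_grade m'' ->
  edge_grade (m + m') = edge_grade (m + m'').
Proof.
move=> /ffunP e; apply/ffunP => p; have := e p; rewrite !ffunE !mnmDE => e'.
by rewrite addnACA e' addnACA.
Qed.

Lemma edge_grade_cut W X : edge_grade (cut_degree edge_src edge_in W X) =
  edge_grade (cut_degree edge_src edge_in X W).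
Proof.
apply/ffunP => -[v u]; rewrite !ffunE !cut_degreeE !edge_srcE.
rewrite !edge_in_sum (adjacent_sym A_sym u v).
by do 4!case: (_ \in _); case: (adj v u).
Qed.

(** An edge contributes when the first of its ends is removed without the other. Hence the grade
    determines [same_part] on edges, and with it the number of parts. *)
Lemma edge_grade_word s v u : word A s ->
  (0 < edge_grade (word_degree edge_src edge_in s) (v, u)) =
    adj v u && ~~ same_part s v u.
Proof.
rewrite ffunE !word_degreeE /=; elim: s => [|W s IH] /=.
  by rewrite /same_part /= !inE andbF.
case/and3P=> /IH {}IH _ /andP[/subsetP WU _].
rewrite !edge_srcE !edge_in_sum /= (adjacent_sym A_sym u v).
rewrite /same_part /= !inE in IH *.
have hs : has (fun P : {set V} => (v \in P) && (u \in P)) s ->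
    (v \notin rest s) && (u \notin rest s).
  by case/hasP=> P Ps /andP[vP uP]; rewrite !(rest_disjoint Ps).
have := WU v; have := WU u; move: IH hs.
have -> : degree_at edge_src edge_in s (enum_rank (v, u)) +
   (if v \in W then nat_of_bool ((u \notin W) && (u \in rest s) && adj v u) else 0) +
   (degree_at edge_src edge_in s (enum_rank (u, v)) +
   (if u \in W then nat_of_bool ((v \notin W) && (v \in rest s) && adj v u) else 0)) =
   degree_at edge_src edge_in s (enum_rank (v, u)) +
   degree_at edge_src edge_in s (enum_rank (u, v)) +
   ((if v \in W then nat_of_bool ((u \notin W) && (u \in rest s) && adj v u) else 0) +
   (if u \in W then nat_of_bool ((v \notin W) && (v \in rest s) && adj v u) else 0)).
  by rewrite addnACA.
move: (degree_at _ _ _ _ + degree_at _ _ _ _) => d; move: (has _ s) => h.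
rewrite addn_gt0; move: (0 < d) => dp.
case: (v \in W); case: (u \in W); case: (v \in rest s); case: (u \in rest s);
  case: h; case: (adj v u) => //= -> //; move=> h1 h2 h3.
all: by try (by have := h1 isT); try (by have := h2 isT); try (by have := h3 isT).
Qed.

Lemma edge_grade_size s t : word A s -> word A t ->
  edge_grade (word_degree edge_src edge_in s) =
    edge_grade (word_degree edge_src edge_in t) -> size s = size t.
Proof.
move=> ws wt e; apply: (size_eq_same_part A_sym connT ws wt) => v u vu.
apply: negb_inj; have := edge_grade_word v u ws; have := edge_grade_word v u wt.
by rewrite e vu /= => -> ->.
Qed.

(** The ordinary degree depends on the edge grade only, so homogeneity survives specialization. It
    is doubled because the grade is stored on ordered pairs. *)
Lemma mdeg_specialize m : (mdeg (specialize m)).*2 =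
  \sum_v \sum_u A v u * edge_grade m (v, u).
Proof.
have -> : mdeg (specialize m) = \sum_v \sum_u A v u * m (enum_rank (v, u)).
  by rewrite mdegE; apply: eq_bigr => v _; rewrite specializeE.
rewrite -addnn {2}exchange_big -big_split; apply: eq_bigr => v _ /=.
rewrite -big_split; apply: eq_bigr => u _ /=.
by rewrite ffunE mulnDr (A_sym u v).
Qed.

End EdgeRing.

(** * Specialization to the vertex variables *)

Section CutDifferential.
Local Open Scope ring_scope.
Variables (K : fieldType) (n : nat) (A : 'M[nat]_n.+1).
Local Notation V := 'I_n.+1.
Local Notation root := (@ord_max n).
Variables (N : nat) (src : 'I_N -> V) (b : 'I_N -> V -> nat).
Local Notation cut := (cut_degree src b).
Local Notation S := {mpoly K[N]}.

(* [e] selects the toppling ideal ([true]) or the parking ideal ([false]).    *)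
Definition cut_ideal_of (e : bool) : S -> Prop :=
  if e then lattice_ideal (K := K) src b else cut_ideal (K := K) src b.

Definition cut_diff (e : bool) : 'M[S]_(word_rank A 1, word_rank A 0) :=
  \matrix_(j, i) ('X_[cut (last_letter j) (~: last_letter j)]
                    - 'X_[cut (~: last_letter j) (last_letter j)] *+ e).

Lemma last_letter0 (j : 'I_(word_rank A 1)) :
  (last_letter j != set0) && (root \notin last_letter j).
Proof.
have := word_atP j; rewrite word_at_cons (tuple0 (word_at (word_par j))) /=.
by case/andP=> -> /and3P[_ ->].
Qed.

Lemma cut_lattice_equiv (X : {set V}) : lattice_equiv src b (cut X (~: X)) (cut (~: X) X).
Proof.
exists (fun w => (w \in X)%:Z) => z; rewrite !cut_degreeE inE.
case: (boolP (src z \in X)) => zX /=.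
  rewrite subr0 (big_morph Posz PoszD (erefl 0%:Z)) big_mkcond /=.
  apply: eq_bigr => w _; rewrite inE; case: (w \in X) => /=.
    by rewrite subrr mulr0.
  by rewrite subr0 mulr1.
rewrite sub0r (big_morph Posz PoszD (erefl 0%:Z)) big_mkcond /= -sumrN.
apply: eq_bigr => w _; case: (w \in X) => /=; first by rewrite sub0r mulrN1.
by rewrite subrr mulr0 oppr0.
Qed.

Lemma cut_diff_ideal e j : augmented (A := A) (cut_ideal_of e) (row j (cut_diff e)).
Proof.
have [i _] := @word_rank0_ex n A.
rewrite (augmentedE _ _ i) !mxE; have /andP[W0 rW] := last_letter0 j.
case: e; rewrite /= ?subr0; apply: ideal_gen_incl.
  exists (cut (last_letter j) (~: last_letter j)).
  exists (cut (~: last_letter j) (last_letter j)).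
  by split; first exact: cut_lattice_equiv.
by exists (last_letter j).
Qed.

Lemma cut_diff_leading e (wt : 'X_{1..N} -> nat) (T : Type) (gam : 'X_{1..N} -> T) :
  (forall X : {set V}, X != set0 -> root \notin X ->
     (wt (cut (~: X) X) < wt (cut X (~: X)))%N) ->
  (forall X Y, gam (cut X Y) = gam (cut Y X)) ->
  leading_terms (@word_par n A) (@code_bound n) (@letter_code n A)
    (@frame_degree n A N src b) wt gam (cut_diff e).
Proof.
move=> lt gc j; set W := last_letter j.
have /andP[W0 rW] := last_letter0 j.
have ej : frame_degree src b j = cut W (~: W).
  apply/mnmP => z; rewrite /frame_degree word_degreeE word_at_cons /=.
  by rewrite (tuple0 (word_at (word_par j))) /= add0n setTD cut_degreeE.
exists (\row_i (- ('X_[cut (~: W) W] *+ e))).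
  apply/matrixP => i0 i; rewrite (ord1 i0) !mxE ej frame_degree0 subm0.
  by rewrite (word_rank0 i (word_par j)) !eqxx mulr1.
move=> i m; rewrite !mxE (perm_mem (msuppN _)); case: e => /=; last by rewrite msupp0.
rewrite mulr1n msuppX inE => /eqP ->; rewrite frame_degree0 addm0 ej; split; last exact: gc.
by rewrite /term_rank /= expn0 !muln1 !addn0 lt.
Qed.

End CutDifferential.

(** * The minimal resolutions of both ideals *)

Section Resolution.
Local Open Scope ring_scope.
Variables (K : fieldType) (n : nat) (A : 'M[nat]_n.+1).
Hypothesis A_sym : forall i j, A i j = A j i.
Local Notation V := 'I_n.+1.
Local Notation root := (@ord_max n).
Hypothesis connT : connected_on A setT.
Local Notation R := {mpoly K[n.+1]}.
Local Notation NE := #|{: V * V}|.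
Local Notation S := {mpoly K[NE]}.

Definition edge_vars : NE.-tuple R :=
  [tuple 'X_[U_(edge_src z) *+ A (edge_src z) (enum_val z).2] | z < NE].

Lemma specializeX m : ('X_[m] : S) \mPo edge_vars = 'X_[specialize A m].
Proof.
rewrite comp_mpolyX (big_morph (fun m => 'X_[m] : R) (@mpolyXD _ _) (@mpolyX0 _ _)).
apply: eq_bigr => z _.
by rewrite tnth_mktuple mpolyXn.
Qed.

Lemma msupp_specialize (p : S) m : m \in msupp (p \mPo edge_vars) ->
  exists2 m', m' \in msupp p & m = specialize A m'.
Proof.
rewrite comp_mpolyEX => /msupp_sum_le/flattenP[/= t /mapP[m']].
rewrite mem_filter => /= m'p -> /msuppZ_le.
by rewrite specializeX msuppX inE => /eqP ->; exists m'.
Qed.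

Definition specialize_mx a b (M : 'M[S]_(a, b)) : 'M[R]_(a, b) :=
  map_mx (comp_mpoly edge_vars) M.

Local Notation degS := (@frame_degree n A NE (@edge_src n) (@edge_in n A)).
Local Notation degR := (@frame_degree n A n.+1 id A).

Lemma specialize_degree k (i : 'I_(word_rank A k)) : specialize A (degS i) = degR i.
Proof. by apply: specialize_word => //; apply: word_atP. Qed.

(** The weight of the edge ring is pulled back, so ranks are preserved. Lower terms may merge with
    each other but never reach the leading one. *)
Lemma specialize_leading k (d : 'M[S]_(word_rank A k.+1, word_rank A k))
    (wt : 'X_{1..n.+1} -> nat) :
  leading_terms (@word_par n A) (@code_bound n) (@letter_code n A) (@degS)
    (fun m => wt (specialize A m)) (@edge_grade n) d ->
  leading_terms (@word_par n A) (@code_bound n) (@letter_code n A) (@degR)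
    wt (fun=> tt) (specialize_mx d).
Proof.
move=> ld j; have [l el al] := ld j; exists (specialize_mx l).
  rewrite /specialize_mx -map_row el map_mxD; congr (_ + _).
  apply/matrixP => i0 i; rewrite (ord1 i0) mxE !termE.
  case: eqP => _; last exact: comp_mpoly0.
  rewrite /= specializeX; congr 'X_[_].
  rewrite -!specialize_degree -{2}(submK (frame_degree_par _ _ j)) specializeD.
  by rewrite addmK.
move=> i m; rewrite mxE => /msupp_specialize[m' /al[lt _] ->]; split=> //.
by rewrite -!specialize_degree -specializeD.
Qed.

Lemma leading_grade k (d : 'M[S]_(word_rank A k.+1, word_rank A k)) wt j i m :
  leading_terms (@word_par n A) (@code_bound n) (@letter_code n A) (@degS)
    wt (@edge_grade n) d ->
  m \in msupp (d j i) -> edge_grade (m + degS i)%MM = edge_grade (degS j).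
Proof.
move=> ld; have [l el al] := ld j.
have -> : d j i = row j d 0 i by rewrite mxE.
rewrite el mxE => /msuppD_le; rewrite mem_cat => /orP[|/al[]//].
rewrite termE; case: eqP => [->|_]; last by rewrite msupp0.
by rewrite msuppX inE => /eqP ->; rewrite submK // frame_degree_par.
Qed.

Lemma cut_ideal_resolution (e : bool) : exists F : free_sequence K n.+1,
  [/\ minimal_graded_free_resolution (cut_ideal_of id A e) F
    & forall k, frank F k = word_rank A k].
Proof.
have [q qP] := superharmonic_exists A_sym connT.
pose wt (m : 'X_{1..n.+1}) := (\sum_i q i * m i)%N.
have wtD m m' : wt (m + m')%MM = (wt m + wt m')%N.
  by rewrite -big_split; apply: eq_bigr => i _; rewrite mnmDE mulnDr.
have wtSD m m' : wt (specialize A (m + m')%MM) =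
    (wt (specialize A m) + wt (specialize A m'))%N.
  by rewrite specializeD wtD.
have wtcut (X Y : {set V}) : wt (cut_degree id A X Y) =
    (\sum_(v in X) \sum_(u in Y) A v u * q v)%N.
  rewrite /wt [RHS]big_mkcond; apply: eq_bigr => v _; rewrite cut_degreeE.
  case: ifP => // _; last by rewrite muln0.
  by rewrite big_distrr; apply: eq_bigr => u _; rewrite mulnC.
(* Sum strict superharmonicity over [X]: the terms inside [X] cancel by symmetry of [A], and the two
   cuts remain. *)
have wtlt (X : {set V}) : X != set0 -> root \notin X ->
    (wt (cut_degree id A (~: X) X) < wt (cut_degree id A X (~: X)))%N.
  move=> X0 rX; rewrite !wtcut.
  have : (\sum_(v in X) \sum_u A v u * q u < \sum_(v in X) \sum_u A v u * q v)%N.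
    case/set0Pn: X0 => x xX; rewrite (bigD1 x) // [X in (_ < X)%N](bigD1 x) //=.
    have ne v : v \in X -> v != root by move=> vX; apply: contraNneq rX => <-.
    rewrite -addSn leq_add ?qP ?ne // leq_sum // => v /andP[vX _].
    by rewrite ltnW ?qP ?ne.
  have split2 (f : V -> V -> nat) : (\sum_(v in X) \sum_u f v u =
      \sum_(v in X) \sum_(u in X) f v u + \sum_(v in X) \sum_(u in ~: X) f v u)%N.
    rewrite -big_split; apply: eq_bigr => v _ /=.
    by rewrite (bigID (mem X)); congr (_ + _)%N; apply: eq_bigl => u //=; rewrite inE.
  rewrite (split2 (fun v u => A v u * q u)%N) (split2 (fun v u => A v u * q v)%N).
  have -> : (\sum_(v in X) \sum_(u in X) A v u * q u =
             \sum_(v in X) \sum_(u in X) A v u * q v)%N.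
    rewrite exchange_big; apply: eq_bigr => v _; apply: eq_bigr => u _.
    by rewrite A_sym.
  rewrite ltn_add2l; congr (_ < _)%N; rewrite exchange_big.
  by apply: eq_bigr => v _; apply: eq_bigr => u _; rewrite A_sym.
have disj (X : {set V}) : [disjoint X & ~: X] by rewrite -subsets_disjoint.
have wtSlt (X : {set V}) : X != set0 -> root \notin X ->
    (wt (specialize A (cut_degree (@edge_src n) (@edge_in n A) (~: X) X)) <
     wt (specialize A (cut_degree (@edge_src n) (@edge_in n A) X (~: X))))%N.
  by move=> X0 rX; rewrite !specialize_cut // ?wtlt // disjoint_sym.
have frS := word_frame A_sym connT (@edge_in_adj n A) (wt := fun m => wt (specialize A m)) wtSD.
have frR := word_frame A_sym connT (src := id) (b := A) (@A_adj n A) wtD.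
have noS : no_standard (@word_par n A) (@degS) (augmented (A := A)
    (cut_ideal_of (K := K) (@edge_src n) (@edge_in n A) e)).
  case: e; first exact: (@lattice_ideal_no_standard n A A_sym connT _ _ _ (@edge_in_adj n A) K).
  exact: (@cut_ideal_no_standard n A A_sym connT _ _ _ (@edge_in_adj n A) K).
have noR : no_standard (@word_par n A) (@degR) (augmented (A := A)
    (cut_ideal_of (K := K) id A e)).
  case: (e); first exact: (@lattice_ideal_no_standard n A A_sym connT _ id A (@A_adj n A) K).
  exact: (@cut_ideal_no_standard n A A_sym connT _ id A (@A_adj n A) K).
have subS : submodule (augmented (A := A) (cut_ideal_of (K := K) (@edge_src n) (@edge_in n A) e)).
  by case: (e); apply: augmented_submodule.
have subR : submodule (augmented (A := A) (cut_ideal_of (K := K) id A e)).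
  by case: (e); apply: augmented_submodule.
have lead0 := cut_diff_leading K (A := A) e (wt := fun m => wt (specialize A m)) wtSlt (edge_grade_cut A_sym).
have [dS dSP d0] := differentials_exist frS (@edge_gradeD n) subS noS
  (@cut_diff_ideal K n A _ _ _ e) lead0.
(* The specialized maps form a complex with the right leading terms, and [noR] starts the same
   division argument in the vertex ring; so they are exact. *)
pose dR k := specialize_mx (dS k).
have [_ ddS ldS] := dSP.
have dRP : differentials (@word_par n A) (@code_bound n) (@letter_code n A) (@degR) wt
    (fun=> tt) (augmented (A := A) (cut_ideal_of (K := K) id A e)) dR.
  split=> [j|k|k]; last exact: specialize_leading.
    have -> : dR 0%N = cut_diff K A id A e.
      rewrite /dR d0; apply/matrixP => j' i; rewrite !mxE rmorphB rmorphMn /= !specializeX.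
      by rewrite !specialize_cut // disjoint_sym.
    exact: cut_diff_ideal.
  by rewrite /dR -map_mxM ddS map_mx0.
have gamD (m M M' : 'X_{1..n.+1}) : tt = tt -> tt = tt by [].
pose F := @FreeSequence K n.+1 (word_rank A) (fun k i => (mdeg (degR i))%:Z) dR (const_mx 1).
exists F; split=> //; split.
- split=> [k i j m|i m].
    rewrite /= mxE => /msupp_specialize[m' m'd ->].
    have eg := leading_grade (ldS k) m'd.
    rewrite /= -PoszD -mdegD -!specialize_degree -specializeD; congr Posz.
    by apply: double_inj; rewrite !mdeg_specialize // eg.
  by rewrite mxE msupp1 inE => /eqP ->; rewrite /= frame_degree0.
- split.
  + have [i0 _] := @word_rank0_ex n A; exists (delta_mx 0 i0).
    rewrite -rowE !mxE subrr.
    by case: (e); apply: ideal_gen0.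
  + move=> v; exact: (differentials_exact0 frR gamD v subR noR dRP).
  move=> k v; exact: (differentials_exact frR gamD v dRP).
move=> k j i; rewrite /= mxE comp_mpolyEX raddf_sum /= big_seq big1 // => m md.
rewrite mcoeffZ specializeX mcoeffX; case: eqP => [e0|_]; last by rewrite mulr0.
have eg := leading_grade (ldS k) md.
(* Variables with [A v u = 0] specialize to 1, but they do not occur in [m], since the grade of
   [degS j] vanishes at such pairs. *)
have m0 : m = 0%MM.
  apply/mnmP => z; rewrite mnm0E -(enum_valK z); case: (enum_val z) => v u.
  have : specialize A m v = 0%N by rewrite e0 mnm0E.
  rewrite specializeE => /eqP; rewrite sum_nat_eq0 => /forallP/(_ u).
  rewrite /= muln_eq0 => /orP[/eqP Avu|/eqP //].
  have : edge_grade (degS j) (v, u) = 0%N.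
    apply/eqP; rewrite -leqn0 leqNgt edge_grade_word ?word_atP //.
    by rewrite /adjacent /= Avu ltnn andbF.
  rewrite -eg ffunE !mnmDE /= => /eqP; rewrite !addn_eq0.
  by case/andP => /andP[/eqP].
(* A nonzero constant entry would give words of lengths [k.+1] and [k] the same grade. *)
have := edge_grade_size A_sym connT (word_atP j) (word_atP i).
move: eg; rewrite m0 add0m => eg /(_ (esym eg)).
by rewrite !size_tuple => /esym/n_Sn.
Qed.

Lemma is_betti_iff (I J : R -> Prop) k c : (forall p, I p <-> J p) ->
  is_betti I k c -> is_betti J k c.
Proof.
move=> IJ [[F rF] uF].
have tr (I' J' : R -> Prop) G : (forall p, I' p <-> J' p) ->
    minimal_graded_free_resolution I' G -> minimal_graded_free_resolution J' G.
  move=> e [gG [[v vI] ex0 ex] mG]; split=> //; split=> //.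
    by exists v; apply/e.
  by move=> w; rewrite -ex0; split=> /e.
split; first by exists F; apply: tr rF.
by move=> G /tr rG; apply: uF; apply: rG => p; apply: iff_sym.
Qed.

Lemma cut_ideal_betti e k : is_betti (cut_ideal_of (K := K) id A e) k (word_rank A k).
Proof.
have [F [rF rk]] := cut_ideal_resolution e; rewrite -rk.
by case: e rF => rF; apply: is_betti_of_resolution.
Qed.

Lemma cut_monomialE (X : {set V}) : cut_monomial K A X = 'X_[cut_degree id A X (~: X)].
Proof.
rewrite mpolyXE_id /cut_monomial big_mkcond; apply: eq_bigr => i _.
by rewrite cut_degreeE; case: ifP.
Qed.

Lemma parking_idealE p : cut_ideal_of (K := K) id A false p <-> parking_ideal K A p.
Proof.
by split; apply: ideal_gen_sub => q [X [X0 rX ->]]; apply: ideal_gen_incl; exists X;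
  rewrite cut_monomialE.
Qed.

Lemma laplacian_row (f : 'rV[int]_n.+1) i :
  (f *m laplacian A) 0 i = \sum_w (A i w)%:Z * (f 0 i - f 0 w).
Proof.
rewrite mulmxBr mxE mul_mx_diag !mxE.
rewrite (big_morph Posz PoszD (erefl 0%:Z)) mulr_sumr -sumrB.
by apply: eq_bigr => w _; rewrite !mxE mulrBr mulrC (A_sym w i) [f 0 w * _]mulrC.
Qed.

Lemma toppling_idealE p : cut_ideal_of (K := K) id A true p <-> toppling_ideal K A p.
Proof.
split; apply: ideal_gen_sub => q [u [v [[f fP] ->]]]; apply: ideal_gen_incl;
  exists u, v; split=> //.
  exists (\row_i f i); apply/rowP => i; rewrite laplacian_row !mxE fP.
  by apply: eq_bigr => w _; rewrite !mxE.
exists (fun w => f 0 w) => z; have /rowP/(_ z) := fP.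
by rewrite laplacian_row mxE.
Qed.

End Resolution.

Theorem theorem1p1 (K : fieldType) (n : nat) (A : 'M[nat]_n.+1)
    (A_sym : forall i j, A i j = A j i)
    (A_conn : connected_on A [set: 'I_n.+1]) (k : nat) :
  is_betti (parking_ideal K A) k
    (\sum_(Pi in connected_partitions A k.+1) alpha A Pi) /\
  is_betti (toppling_ideal K A) k
    (\sum_(Pi in connected_partitions A k.+1) alpha A Pi).
Proof.
rewrite -card_words //; split.
  by apply: is_betti_iff (cut_ideal_betti K A_sym A_conn false k); apply: parking_idealE.
by apply: is_betti_iff (cut_ideal_betti K A_sym A_conn true k); apply: toppling_idealE.
Qed.
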